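(* Let $\Lambda\in\mathcal{L}$, $c\in C^0_{\Lambda^m}$, $\hat w,w\in W^c$ and $f\in\mathbb{F}[\Lambda^m]$. Then $$\gamma^m_w\big(\pi^m_v(\mathbf{1}^+fT_{\hat w})x^c\big)=h^{m,c}_v(w)\,v^{l(w_0)/2}\cdot w_0\,\pi^m_v\big(T_{(w_0w)^{-1}}^{-1}\,\mathbf{1}^+_{W_c}\,T_{\hat w^{-1}}\big)f .$$
   Context: Let $E$ be a Euclidean space with dual $E^*$ and $\Phi\subset E^*$ a reduced irreducible root system (in its span). For $\alpha\in\Phi$, $\alpha^\vee\in E$ is the vector with $\langle y,\alpha^\vee\rangle=2\alpha(y)/\|\alpha\|^2$ for all $y\in E$. Fix simple roots $\alpha_1,\dots,\alpha_r$ and positive roots $\Phi^+$; $W$ is the finite Weyl group, with simple reflections $s_i$, acting on $E$ by $s_\alpha(y)=y-\alpha(y)\alpha^\vee$; $l$ is the length, $w_0$ the longest element, $\Pi(w)=\Phi^+\cap w^{-1}\Phi^-$. $Q^\vee$ is the coroot lattice. $\mathcal{L}$ is the set of finitely generated abelian subgroups $\Lambda\subset E$ with $Q^\vee\subseteq\Lambda$ and $\alpha(\Lambda)\subseteq\mathbb{Z}$ for all $\alpha\in\Phi$. $\mathbb{F}$ is a field containing a nonzero $v$ with fixed square root $v^{1/2}$; $\mathbb{F}[\Lambda]$ has basis $x^\lambda$ and $wx^\lambda=x^{w\lambda}$; $\mathbb{F}[S]$ is the span of $x^\lambda$, $\lambda\in S$. Metaplectic data: $n\in\mathbb{Z}_{\ge1}$;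 $\mathbf{Q}:\Lambda\to\mathbb{Q}$ a nonzero $W$-invariant quadratic form, integer valued on $Q^\vee$; $\mathbf{B}(\lambda,\mu)=\mathbf{Q}(\lambda+\mu)-\mathbf{Q}(\lambda)-\mathbf{Q}(\mu)$, so $\mathbf{B}(\lambda,\alpha^\vee)=\mathbf{Q}(\alpha^\vee)\alpha(\lambda)$; $m(\alpha)=n/\gcd(n,\mathbf{Q}(\alpha^\vee))$; $\Lambda^m=\{\lambda\in\Lambda:m(\alpha)\mid\alpha(\lambda)\ \forall\alpha\in\Phi\}$. $\widetilde W_{\Lambda^m}=W\ltimes\Lambda^m$ acts on $E$ with $\Lambda^m$ acting by translations. $C^0_{\Lambda^m}$ is the set of $c\in\Lambda$ with $0\le\alpha(c)\le m(\alpha)$ for all $\alpha\in\Phi^+$ whose stabilizer in $\widetilde W_{\Lambda^m}$ equals its stabilizer $W_c$ in $W$. $W^c$ is the set of minimal length representatives of $W/W_c$. $\mathbb{F}[\widetilde{\mathcal{O}}_{\Lambda^m,c}]$, with $\widetilde{\mathcal{O}}_{\Lambda^m,c}=\{\lambda+wc:\lambda\in\Lambda^m,w\in W\}$, is free over $\mathbb{F}[\Lambda^m]$ with basis $x^{wc}$ ($w\in W^c$), and $\gamma^m_w=\gamma^m_{w,c}$ is defined by $f=\sum_{w\in W^c}\gamma^m_w(f)x^{wc}$. $\widetilde{\mathcal{H}}_{\Lambda^m}$ (equal Hecke parameters $t_i=v^{1/2}$) is generated by $T_1,\dots,T_r$, $x^\lambda$ ($\lambda\in\Lambda^m$), with the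 braid relations of $W$, $(T_i-v^{1/2})(T_i+v^{-1/2})=0$, $x^\lambda x^\mu=x^{\lambda+\mu}$, $x^0=1$, $T_ix^\lambda-x^{s_i\lambda}T_i=(v^{1/2}-v^{-1/2})\frac{x^{s_i\lambda}-x^\lambda}{x^{m(\alpha_i)\alpha_i^\vee}-1}$. $T_w=T_{i_1}\cdots T_{i_k}$ for a reduced expression. $\mathbf{1}^+=\sum_{w\in W}v^{l(w)/2}T_w$, $\mathbf{1}^+_{W_c}=\sum_{w\in W_c}v^{l(w)/2}T_w$. Parameters $g_j\in\mathbb{F}^\times$ ($j\in\mathbb{Z}$): $g_j=-1$ if $n\mid j$; $g_{j+n}=g_j$; $g_jg_{n-j}=v^{-1}$ if $n\nmid j$. Metaplectic representation $\pi^m_v$ of $\widetilde{\mathcal{H}}_{\Lambda^m}$ on $\mathbb{F}[\Lambda]$ (preserving $\mathbb{F}[\widetilde{\mathcal{O}}_{\Lambda^m,c}]$ and $\mathbb{F}[\Lambda^m]$): $\pi^m_v(x^\mu)x^\lambda=x^{\lambda+\mu}$ ($\mu\in\Lambda^m$) and $$\pi^m_v(T_i)x^\lambda=-v^{1/2}g_{-\mathbf{B}(\lambda,\alpha_i^\vee)}x^{s_i\lambda}+(v^{1/2}-v^{-1/2})\frac{1-x^{(r_{m(\alpha_i)}(\alpha_i(\lambda))-\alpha_i(\lambda))\alpha_i^\vee}}{1-x^{m(\alpha_i)\alpha_i^\vee}}\,x^\lambda,$$ where $r_m(a)\in\{0,\dots,m-1\}$ is the residue of $a$ mod $m$. Finally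 $h^{m,c}_v(w)=(-1)^{l(w)}v^{l(w)/2}\prod_{\alpha\in\Pi(w)}g_{-\mathbf{B}(c,\alpha^\vee)}$. *)

(* Defs.v *)
From HB Require Import structures.
From mathcomp Require Import all_boot all_order all_algebra all_fingroup.
From mathcomp Require Import finmap monalg.
From mathcomp Require Import boolp classical_sets reals.

Set Implicit Arguments.
Unset Strict Implicit.
Unset Printing Implicit Defensive.

Import Order.TTheory GRing.Theory Num.Theory.
Local Open Scope ring_scope.

(* E is R^d, realized as column vectors with the standard inner product, and  *)
(* E^* is the space of row vectors; a linear map of E is a matrix acting on   *)
(* the left.                                                                  *)

Section RootSystem.
Variables (R : realType) (d : nat).
Implicit Types (a b : 'rV[R]_d) (y : 'cV[R]_d).

Definition ev a y : R := (a *m y) 0 0.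

Definition inner (y z : 'cV[R]_d) : R := (y^T *m z) 0 0.

Definition sqnorm a : R := (a *m a^T) 0 0.

Definition coroot a : 'cV[R]_d := (2 / sqnorm a) *: a^T.

Lemma inner_coroot a y : inner y (coroot a) = 2 * ev a y / sqnorm a.
Proof.
by rewrite /inner /coroot -scalemxAr mxE -trmx_mul [in LHS]mxE mulrAC.
Qed.

Definition refl_mx a : 'M[R]_d := 1%:M - coroot a *m a.

Lemma refl_mxE a y : refl_mx a *m y = y - ev a y *: coroot a.
Proof.
rewrite /refl_mx mulmxBl mul1mx -mulmxA [a *m y]mx11_scalar.
by rewrite mul_mx_scalar.
Qed.

Record irreducible_root_system (Phi : {fset 'rV[R]_d}) : Prop := {
  rs_neq0 : forall a, a \in Phi -> a != 0;
  rs_refl : forall a b, a \in Phi -> b \in Phi ->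
    b - ev b (coroot a) *: a \in Phi;
  rs_int : forall a b, a \in Phi -> b \in Phi ->
    ev b (coroot a) \is a Num.int;
  rs_reduced : forall a (k : R), a \in Phi -> k *: a \in Phi ->
    k = 1 \/ k = -1;
  rs_nonempty : Phi != fset0;
  rs_irreducible : forall A : {fset 'rV[R]_d},
    (A `<=` Phi)%fset -> A != fset0 ->
    (forall a b, a \in A -> b \in Phi -> b \notin A -> (a *m b^T) 0 0 = 0) ->
    A = Phi
}.

Definition is_base (Phi : {fset 'rV[R]_d}) r (Delta : r.-tuple 'rV[R]_d) :=
  [/\ free Delta,
      forall i, tnth Delta i \in Phi &
      forall a, a \in Phi -> exists k : 'I_r -> nat,
        a = \sum_i tnth Delta i *+ k i \/ a = - \sum_i tnth Delta i *+ k i].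

(* For a in Phi: a is a positive root. *)
Definition positive r (Delta : r.-tuple 'rV[R]_d) a :=
  [forall i, 0 <= coord Delta i a].

End RootSystem.

Section WeylGroup.
Variables (R : realType) (d : nat) (W : finGroupType) (rho : W -> 'M[R]_d).

(* The element of W acting on E as the reflection in the root a. *)
Definition sref (a : 'rV[R]_d) : W := odflt 1%g [pick w | rho w == refl_mx a].

Record is_weyl_group (Phi : {fset 'rV[R]_d}) : Prop := {
  wg_1 : rho 1%g = 1%:M;
  wg_M : forall u w, rho (u * w)%g = rho u *m rho w;
  wg_inj : injective rho;
  wg_refl : forall a, a \in Phi -> rho (sref a) = refl_mx a;
  wg_gen : <<[set:: [seq sref a | a <- Phi]]>>%g = [set: W]
}.

Definition stab (c : 'cV[R]_d) : {set W} := [set w | rho w *m c == c].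

Variables (r : nat) (Delta : r.-tuple 'rV[R]_d).

Definition srefl (i : 'I_r) : W := sref (tnth Delta i).

Definition has_word (w : W) (k : nat) :=
  [exists t : k.-tuple 'I_r, \prod_(i <- t) srefl i == w]%g.

(* The least k such that w is a product of k simple reflections; the partial  *)
(* products of a shortest word are pairwise distinct, hence k < #|W|.         *)
Definition wlen (w : W) : nat := find (has_word w) (iota 0 #|W|).

Definition reduced_word (w : W) : seq 'I_r :=
  if [pick t : (wlen w).-tuple 'I_r | \prod_(i <- t) srefl i == w]%g is Some t
  then t else [::].

Definition longest : W := [arg max_(w > 1%g) wlen w].

Definition min_coset_reps (c : 'cV[R]_d) : {set W} :=
  [set w | [forall u in stab c, (wlen w <= wlen (w * u)%g)%N]].

(* W acts on E^* by (w a)(y) = a (w^-1 y).                                    *)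
Definition inversion (w : W) (a : 'rV[R]_d) :=
  positive Delta a && positive Delta (- (a *m rho w^-1%g)).

End WeylGroup.

Section GroupAlgebra.
Variables (R : realType) (d : nat) (F : fieldType).

(* F[E]; for a subset S of E, F[S] is the subspace of the f with              *)
(* supported S f.                                                             *)
Definition galg := {malg F['cV[R]_d]}.
Implicit Types (f g : galg) (y : 'cV[R]_d).

Definition xpow y : galg := << y >>.

Definition supported (S : {pred 'cV[R]_d}) f := {subset msupp f <= S}.

(* {malg F[K]} is a ring only for monoids K without nontrivial units, which   *)
(* excludes groups, so the product is defined here.                           *)
Definition gmul f g : galg :=
  \sum_(y <- msupp f) \sum_(z <- msupp g) (f@_y * g@_z) *: xpow (y + z).

(* The quotient of f by g, when it exists. F[E] is an integral domain, so     *)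
(* that it is unique for g != 0.                                              *)
Definition gdiv f g : galg := xget 0 [set q | gmul q g = f]%classic.

Definition xact (M : 'M[R]_d) f : galg :=
  \sum_(y <- msupp f) f@_y *: xpow (M *m y).

End GroupAlgebra.

Section Lattice.
Variables (R : realType) (d : nat) (Phi : {fset 'rV[R]_d}).

Definition coroot_lattice (y : 'cV[R]_d) :=
  inIntSpan (in_tuple [seq coroot a | a <- Phi]) y.

(* The set \mathcal{L}. *)
Record admissible_lattice (Lam : {pred 'cV[R]_d}) : Prop := {
  lat_fg : exists (k : nat) (gens : k.-tuple 'cV[R]_d),
    forall y, y \in Lam <-> inIntSpan gens y;
  lat_coroot : forall y, coroot_lattice y -> y \in Lam;
  lat_int : forall a y, a \in Phi -> y \in Lam -> ev a y \is a Num.int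
}.

Variables (n : nat) (Q : 'cV[R]_d -> rat).

Definition bform (y z : 'cV[R]_d) : rat := Q (y + z) - Q y - Q z.

(* Q is only meaningful on Lam. *)
Record metaplectic_form (W : finGroupType) (rho : W -> 'M[R]_d)
    (Lam : {pred 'cV[R]_d}) : Prop := {
  mf_scale : forall (k : int) y, y \in Lam -> Q (y *~ k) = k%:~R ^+ 2 * Q y;
  mf_add : forall y y' z, y \in Lam -> y' \in Lam -> z \in Lam ->
    bform (y + y') z = bform y z + bform y' z;
  mf_neq0 : exists2 y, y \in Lam & Q y != 0;
  mf_W : forall (w : W) y, y \in Lam -> Q (rho w *m y) = Q y;
  mf_int : forall y, coroot_lattice y -> Q y \is a Num.int
}.

(* Num.floor only turns integral elements of R or rat into elements of int,   *)
(* here and below.                                                            *)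
Definition mult (a : 'rV[R]_d) : nat :=
  (n %/ gcdn n `|Num.floor (Q (coroot a))|)%N.

Definition iev (a : 'rV[R]_d) (y : 'cV[R]_d) : int := Num.floor (ev a y).

Definition ibform (y : 'cV[R]_d) (a : 'rV[R]_d) : int :=
  Num.floor (bform y (coroot a)).

(* The lattice \Lambda^m. *)
Definition sublat (Lam : {pred 'cV[R]_d}) : {pred 'cV[R]_d} :=
  [pred y | (y \in Lam) && all (fun a => (mult a %| iev a y)%Z) Phi].

Variables (W : finGroupType) (rho : W -> 'M[R]_d).
Variables (r : nat) (Delta : r.-tuple 'rV[R]_d) (Lam : {pred 'cV[R]_d}).

(* The set C^0; (w, mu) in W |x \Lambda^m acts on E by y |-> mu + w y.        *)
Record in_C0 (c : 'cV[R]_d) : Prop := {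
  C0_lat : c \in Lam;
  C0_bounds : forall a, a \in Phi -> positive Delta a ->
    0 <= ev a c <= (mult a)%:R;
  C0_stab : forall (w : W) mu, mu \in sublat Lam ->
    mu + rho w *m c = c <-> w \in stab rho c /\ mu = 0
}.

Definition orbit_pts (c : 'cV[R]_d) : {pred 'cV[R]_d} :=
  [pred y | [exists w : W, y - rho w *m c \in sublat Lam]].

Variable F : fieldType.

(* gamma w is the coordinate function on F[orbit_pts c] with respect to the   *)
(* element x^(w c) of the F[\Lambda^m]-basis indexed by W^c.                  *)
Definition coordinate_functions (c : 'cV[R]_d)
    (gamma : W -> galg R d F -> galg R d F) :=
  forall f, supported (orbit_pts c) f ->
    (forall w, w \in min_coset_reps rho Delta c ->
       supported (sublat Lam) (gamma w f)) /\
    f = \sum_(w in min_coset_reps rho Delta c)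
          gmul (gamma w f) (xpow F (rho w *m c)).

Record gauss_parameters (v : F) (g : int -> F) : Prop := {
  gp_neq0 : forall j, g j != 0;
  gp_m1 : forall j, (n %| j)%Z -> g j = -1;
  gp_period : forall j, g (j + n%:Z) = g j;
  gp_mul : forall j, ~~ (n %| j)%Z -> g j * g (n%:Z - j) = v^-1
}.

(* vh is v^{1/2} *)
Definition hfun (vh : F) (g : int -> F) (c : 'cV[R]_d) (w : W) : F :=
  (-1) ^+ wlen rho Delta w * vh ^+ wlen rho Delta w *
  \prod_(a <- Phi | inversion rho Delta w a) g (- ibform c a).

Section Hecke.
Variable vh : F.

Section Generators.
Variables (A : algType F) (T : 'I_r -> A) (X : 'cV[R]_d -> A).

Definition x_embed (f : galg R d F) : A := \sum_(y <- msupp f) f@_y *: X y.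

(* The product a b a ... with k factors. *)
Fixpoint alt_prod (k : nat) (a b : A) : A :=
  if k is k'.+1 then a * alt_prod k' b a else 1.

Record hecke_relations : Prop := {
  hr_braid : forall i j,
    let k := #[(srefl rho Delta i * srefl rho Delta j)%g]%g in
    alt_prod k (T i) (T j) = alt_prod k (T j) (T i);
  hr_quad : forall i, (T i - vh%:A) * (T i + (vh^-1)%:A) = 0;
  hr_X : forall y z, y \in sublat Lam -> z \in sublat Lam ->
    X y * X z = X (y + z);
  hr_X0 : X 0 = 1;
  hr_cross : forall i y, y \in sublat Lam ->
    let a := tnth Delta i in
    T i * X y - X (refl_mx a *m y) * T i =
    (vh - vh^-1) *:
      x_embed (gdiv (xpow F (refl_mx a *m y) - xpow F y)
                    (xpow F (coroot a *+ mult a) - xpow F 0))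
}.

Definition hecke_T (w : W) : A := \prod_(i <- reduced_word rho Delta w) T i.

Definition one_plus (S : {set W}) : A :=
  \sum_(w in S) vh ^+ wlen rho Delta w *: hecke_T w.

End Generators.

(* H is the algebra presented by the generators T_i, x^y (y in \Lambda^m) and *)
(* the relations above.                                                       *)
Definition is_hecke_algebra (H : algType F) (T : 'I_r -> H)
    (X : 'cV[R]_d -> H) :=
  hecke_relations T X /\
  forall (A : algType F) (T' : 'I_r -> A) (X' : 'cV[R]_d -> A),
    hecke_relations T' X' ->
    let extends (phi : H -> A) :=
      (forall i, phi (T i) = T' i) /\
      (forall y, y \in sublat Lam -> phi (X y) = X' y) in
    exists2 phi : {lrmorphism H -> A}, extends phi &
      forall psi : {lrmorphism H -> A}, extends psi -> psi =1 phi.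

(* The representation pi on F[Lam]; the values of pi h outside F[Lam] are     *)
(* irrelevant.                                                                *)
Record metaplectic_rep (g : int -> F) (H : algType F) (T : 'I_r -> H)
    (X : 'cV[R]_d -> H) (pi : H -> galg R d F -> galg R d F) : Prop := {
  mr_stable : forall h f, supported Lam f -> supported Lam (pi h f);
  mr_linear : forall h (k : F) f f', supported Lam f -> supported Lam f' ->
    pi h (k *: f + f') = k *: pi h f + pi h f';
  mr_linearH : forall (k : F) h h' f, supported Lam f ->
    pi (k *: h + h') f = k *: pi h f + pi h' f;
  mr_1 : forall f, supported Lam f -> pi 1 f = f;
  mr_M : forall h h' f, supported Lam f -> pi (h * h') f = pi h (pi h' f);
  mr_X : forall mu y, mu \in sublat Lam -> y \in Lam ->
    pi (X mu) (xpow F y) = xpow F (y + mu);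
  mr_T : forall i y, y \in Lam ->
    let a := tnth Delta i in
    pi (T i) (xpow F y) =
      - (vh * g (- ibform y a)) *: xpow F (refl_mx a *m y) +
      (vh - vh^-1) *:
        gmul (gdiv (xpow F 0 -
                      xpow F (coroot a *~ ((iev a y %% mult a)%Z - iev a y)))
                   (xpow F 0 - xpow F (coroot a *+ mult a)))
             (xpow F y)
}.

End Hecke.

End Lattice.

(* Main.v *)
Require Import Defs.
From HB Require Import structures.
From mathcomp Require Import all_boot all_order all_algebra all_fingroup.
From mathcomp Require Import cyclic finmap monalg.
From mathcomp Require Import boolp classical_sets reals.

Set Implicit Arguments.
Unset Strict Implicit.
Unset Printing Implicit Defensive.

Import Order.TTheory GRing.Theory Num.Theory.
Local Open Scope ring_scope.

(* With D_i(f) = (s_i f - f) / (x^{m(al_i) al_i^vee} - 1), the relations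
   f T_i = T_i s_i(f) + (v^{1/2} - v^{-1/2}) D_i(f) and 1^+ T_i = v^{1/2} 1^+ of
   the Hecke algebra give 1^+ f T_i = 1^+ (pi(T_i) f), hence
   1^+ f T_w' = 1^+ (pi(T_{w'^-1}) f).  For c in C^0 the second term of
   pi(T_i) x^{wc} vanishes when s_i w > w, so that T_w x^c = h(w) x^{wc} and
   F[Lam^m] x^c is isomorphic to F[Lam^m] as a module over the parabolic
   subalgebra of W_c.  With 1^+ = (sum over W^c of v^{l(w)/2} T_w) 1^+_{W_c}, the
   left-hand side is therefore the coefficient at x^{wc} of
   psi = sum over W^c of v^{l(w)/2} T_w (phi x^c), where
   phi = pi(1^+_{W_c} T_{w'^-1}) f.  At the longest w in W^c it is the leading
   coefficient h(w) v^{l(w)/2} w(phi); the equations T_i psi = v^{1/2} psi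
   determine the others. *)

(** * Reflections *)

(** The lower terms of T_w (phi x^c) are never computed: only their lengths are tracked, and the top
    coefficient sees none of them. Let w < s_i w with w and s_i w in W^c, and kappa = v^{1/2} -
    v^{-1/2}. The coefficient of T_i psi = v^{1/2} psi at x^{wc} says that s_i of the coefficient at
    s_i w equals h(s_i w)/h(w) times (v^{1/2} - kappa D_i) of the one at w. Now s_i (v^{1/2} - kappa
    D_i) is the action of T_i with -al_i in place of al_i, and conjugation by w0 turns it into
    pi(T_j), where s_j = w0 s_i w0. This is the origin of the outer w0; the inverses T_j^{-1}
    collected on the way down from the top multiply to T_{(w0 w)^{-1}}^{-1}. At the top, (w0 w)^{-1}
    is the longest element u0 of W_c, and T_{u0} acts on phi by v^{l(u0)/2}; absorbing this scalar
    turns v^{l(w)/2} into v^{l(w0)/2}. *)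

Section Reflections.
Variables (R : realType) (d : nat).
Implicit Types (a b : 'rV[R]_d) (y z : 'cV[R]_d).

Lemma evD a y z : ev a (y + z) = ev a y + ev a z.
Proof. by rewrite /ev mulmxDr mxE. Qed.

Lemma evZ a (k : R) y : ev a (k *: y) = k * ev a y.
Proof. by rewrite /ev -scalemxAr mxE. Qed.

Lemma evN a y : ev a (- y) = - ev a y.
Proof. by rewrite -scaleN1r evZ mulN1r. Qed.

Lemma ev0 a : ev a 0 = 0.
Proof. by rewrite /ev mulmx0 mxE. Qed.

Lemma ev_mul a (M : 'M_d) y : ev a (M *m y) = ev (a *m M) y.
Proof. by rewrite /ev mulmxA. Qed.

Lemma evZl (k : R) a y : ev (k *: a) y = k * ev a y.
Proof. by rewrite /ev -scalemxAl mxE. Qed.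

Lemma ev_suml n (F : 'I_n -> 'rV[R]_d) y : ev (\sum_i F i) y = \sum_i ev (F i) y.
Proof. by rewrite /ev mulmx_suml summxE. Qed.

Lemma sqnormE a : sqnorm a = \sum_j a 0 j ^+ 2.
Proof. by rewrite /sqnorm mxE; apply: eq_bigr => j _; rewrite mxE expr2. Qed.

Lemma sqnorm_gt0 a : a != 0 -> 0 < sqnorm a.
Proof.
move=> a0; rewrite lt_neqAle sqnormE sumr_ge0 ?andbT; last first.
  by move=> j _; apply: sqr_ge0.
apply: contraNN a0; rewrite eq_sym psumr_eq0 => [/allP h|j _]; last exact: sqr_ge0.
apply/eqP/rowP => j; rewrite mxE.
by have := h j (mem_index_enum _); rewrite /= sqrf_eq0 => /eqP.
Qed.

Lemma sqnormN a : sqnorm (- a) = sqnorm a.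
Proof. by rewrite /sqnorm linearN /= mulmxN mulNmx opprK. Qed.

Lemma corootN a : coroot (- a) = - coroot a.
Proof. by rewrite /coroot sqnormN linearN /= scalerN. Qed.

Lemma refl_mxN a : refl_mx (- a) = refl_mx a.
Proof. by rewrite /refl_mx corootN mulmxN mulNmx opprK. Qed.

Lemma row_refl a b : a *m refl_mx b = a - ev a (coroot b) *: b.
Proof.
rewrite /refl_mx mulmxBr mulmx1 mulmxA.
by rewrite [a *m coroot b]mx11_scalar mul_scalar_mx.
Qed.

Lemma ev_coroot_inner a b : ev a (coroot b) = 2 / sqnorm b * (a *m b^T) 0 0.
Proof. by rewrite /ev /coroot -scalemxAr mxE. Qed.

Lemma ev_coroot_id a : a != 0 -> ev a (coroot a) = 2.
Proof.
move=> a0; rewrite ev_coroot_inner -/(sqnorm a) divfK //.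
by rewrite gt_eqF // sqnorm_gt0.
Qed.

Lemma coroot_neq0 a : a != 0 -> coroot a != 0.
Proof.
move=> a0; apply/eqP => h; have := ev_coroot_id a0.
by rewrite h ev0 => /eqP; rewrite eq_sym pnatr_eq0.
Qed.

Lemma row_refl_id a : a != 0 -> a *m refl_mx a = - a.
Proof.
move=> a0; rewrite row_refl ev_coroot_id // scaler_nat mulr2n opprD addrA.
by rewrite subrr add0r.
Qed.

Lemma refl_mx_tr a : (refl_mx a)^T = refl_mx a.
Proof.
rewrite /refl_mx linearB /= trmx1 trmx_mul /coroot linearZ /= trmxK.
by rewrite -scalemxAr -scalemxAl.
Qed.

Lemma refl_mxK a : a != 0 -> refl_mx a *m refl_mx a = 1%:M.
Proof.
move=> a0; rewrite {1}/refl_mx mulmxBl mul1mx -mulmxA row_refl_id //.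
by rewrite mulmxN opprK subrK.
Qed.

Lemma coroot_orth a (M : 'M_d) : M *m M^T = 1%:M ->
  coroot (a *m M) = M^T *m coroot a.
Proof.
move=> h; rewrite /coroot trmx_mul -scalemxAr; congr (_ / _ *: _).
by rewrite /sqnorm trmx_mul -mulmxA (mulmxA M) h mul1mx.
Qed.

Lemma refl_mx_orth a (M : 'M_d) : M *m M^T = 1%:M ->
  refl_mx (a *m M) = M^T *m refl_mx a *m M.
Proof.
move=> h; rewrite /refl_mx coroot_orth // mulmxBr mulmx1 mulmxBl !mulmxA.
by rewrite (mulmx1C h).
Qed.

Lemma refl_mx_inj a b : a != 0 -> refl_mx a = refl_mx b ->
  exists k : R, a = k *: b.
Proof.
move=> a0 h; have := row_refl_id a0; rewrite h row_refl => e.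
exists (ev a (coroot b) / 2); rewrite mulrC -scalerA.
have -> : ev a (coroot b) *: b = 2 *: a.
  by rewrite -[LHS](subKr a) e opprK scaler_nat mulr2n.
by rewrite scalerA mulVf ?scale1r // pnatr_eq0.
Qed.

End Reflections.

(** * The group algebra *)

Section GroupAlgebraLinearity.
Variables (R : realType) (d : nat) (F : fieldType).
Implicit Types (f g q : galg R d F) (y z b : 'cV[R]_d) (k : F).

Section LinearExtension.
Variables (V : lmodType F) (p : 'cV[R]_d -> V).

(** [xact] and [x_embed] are instances of this sum by conversion, and [gmul] is a twofold one, so a
    single linearity proof serves all three. *)
Definition lext f : V := \sum_(y <- msupp f) f@_y *: p y.

Lemma lextw (D : {fset 'cV[R]_d}) f : (msupp f `<=` D)%fset ->
  lext f = \sum_(y <- D) f@_y *: p y.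
Proof.
move=> h; rewrite /lext (big_fset_incl _ h) // => y _ /mcoeff_outdom ->.
by rewrite scale0r.
Qed.

Lemma lext_is_linear : linear lext.
Proof.
move=> k f g; pose D := (msupp f `|` msupp g)%fset.
have hf : (msupp f `<=` D)%fset by rewrite fsubsetUl.
have hg : (msupp g `<=` D)%fset by rewrite fsubsetUr.
rewrite (lextw hf) (lextw hg) (@lextw D); last first.
  apply: fsubset_trans (msuppD_le _ _) _; apply: fsetSU; exact: msuppZ_le.
rewrite scaler_sumr -big_split; apply: eq_bigr => y _ /=.
by rewrite mcoeffD mcoeffZ scalerDl scalerA.
Qed.

HB.instance Definition _ := GRing.isLinear.Build F (galg R d F) V _ lext lext_is_linear.

Lemma lext_xpow y : lext (xpow F y) = p y.
Proof. by rewrite (lextw msuppU_le) big_seq_fset1 mcoeffUU scale1r. Qed.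

End LinearExtension.

Lemma gmulE f g : gmul f g = lext (fun y => lext (fun z => xpow F (y + z)) g) f.
Proof.
apply: eq_bigr => y _; rewrite scaler_sumr; apply: eq_bigr => z _.
by rewrite scalerA.
Qed.

Lemma gmul_is_linear f : linear (gmul f).
Proof.
move=> k g g'; rewrite !gmulE /lext scaler_sumr -big_split; apply: eq_bigr => y _ /=.
by rewrite -/(lext _ _) linearP scalerDr !scalerA mulrC.
Qed.

Lemma gmulPr f k g g' : gmul f (k *: g + g') = k *: gmul f g + gmul f g'.
Proof. exact: gmul_is_linear. Qed.

Lemma gmulPl k f f' g : gmul (k *: f + f') g = k *: gmul f g + gmul f' g.
Proof. by rewrite !gmulE linearP. Qed.

Lemma gmul_xpow y z : gmul (xpow F y) (xpow F z) = xpow F (y + z).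
Proof. by rewrite gmulE !lext_xpow. Qed.

Lemma xactP (M : 'M[R]_d) k f g : xact M (k *: f + g) = k *: xact M f + xact M g.
Proof. exact: (lext_is_linear (fun y => xpow F (M *m y))). Qed.

Lemma xact_xpow (M : 'M[R]_d) y : xact M (xpow F y) = xpow F (M *m y).
Proof. exact: (lext_xpow (fun y => xpow F (M *m y))). Qed.

Lemma mcoeffP z k f g : (k *: f + g)@_z = k * f@_z + g@_z.
Proof. by rewrite mcoeffD mcoeffZ. Qed.

Lemma mcoeff_xpow y z : (xpow F y)@_z = (y == z)%:R.
Proof. exact: mcoeffU. Qed.

Lemma galg_fin f : exists s : seq 'cV[R]_d, f = \sum_(y <- s) f@_y *: xpow F y.
Proof.
exists (msupp f); rewrite {1}[f]monalgE; apply: eq_bigr => y _; apply/malgP => z.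
by rewrite [RHS]mcoeffZ [LHS]mcoeffU [in RHS]mcoeffU mulrnAr mulr1.
Qed.

End GroupAlgebraLinearity.

(* F[E] is only handled through these properties: comparing two scaled elements
   of [{malg F[K]}] by conversion unfolds the whole construction. *)
Record group_algebra (R : realType) (d : nat) (F : fieldType) (V : lmodType F)
    (co : 'cV[R]_d -> V -> F) (x : 'cV[R]_d -> V) (mul : V -> V -> V) : Prop := {
  ga_coP : forall z k f g, co z (k *: f + g) = k * co z f + co z g;
  ga_co_x : forall y z, co z (x y) = (y == z)%:R;
  ga_fin : forall f, exists s : seq 'cV[R]_d, f = \sum_(y <- s) co y f *: x y;
  ga_mulPl : forall k f f' g, mul (k *: f + f') g = k *: mul f g + mul f' g;
  ga_mulPr : forall f k g g', mul f (k *: g + g') = k *: mul f g + mul f g';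
  ga_mul_x : forall y z, mul (x y) (x z) = x (y + z)
}.

Lemma galg_group_algebra (R : realType) (d : nat) (F : fieldType) :
  @group_algebra R d F (galg R d F) (fun z f => f@_z) (@xpow R d F) (@gmul R d F).
Proof.
split; [exact: mcoeffP | exact: mcoeff_xpow | exact: galg_fin | exact: gmulPl | |
        exact: gmul_xpow].
by move=> f k g g'; apply: gmulPr.
Qed.

Section GroupAlgebraTheory.
Variables (R : realType) (d : nat) (F : fieldType) (V : lmodType F).
Variables (co : 'cV[R]_d -> V -> F) (x : 'cV[R]_d -> V) (mul : V -> V -> V).
Hypothesis hV : group_algebra co x mul.
Implicit Types (S : {pred 'cV[R]_d}) (f g q : V) (y z b : 'cV[R]_d) (k : F).

Definition supp S f := forall y, co y f != 0 -> y \in S.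

Lemma ga_co0 z : co z 0 = 0.
Proof.
have := ga_coP hV z 1 0 0; rewrite scaler0 addr0 mul1r => /eqP.
by rewrite -subr_eq0 opprD addNKr oppr_eq0 => /eqP.
Qed.

Lemma ga_supp0 S : supp S 0.
Proof. by move=> z; rewrite ga_co0 eqxx. Qed.

Lemma suppP S k f g : supp S f -> supp S g -> supp S (k *: f + g).
Proof.
move=> hf hg z; rewrite (ga_coP hV); have [/hf //|] := boolP (co z f != 0).
by rewrite negbK => /eqP ->; rewrite mulr0 add0r; apply: hg.
Qed.

Lemma suppD S f g : supp S f -> supp S g -> supp S (f + g).
Proof. by move=> hf hg; rewrite -[f]scale1r; apply: suppP. Qed.

Lemma suppZ S k f : supp S f -> supp S (k *: f).
Proof. by move=> hf; rewrite -[_ *: _]addr0; apply/suppP/ga_supp0. Qed.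

Lemma suppB S f g : supp S f -> supp S g -> supp S (f - g).
Proof. by move=> hf hg; rewrite addrC -scaleN1r; apply: suppP. Qed.

Lemma supp_sum (I : Type) (s : seq I) (P : pred I) S (G : I -> V) :
  (forall i, P i -> supp S (G i)) -> supp S (\sum_(i <- s | P i) G i).
Proof. by move=> h; elim/big_ind: _ => // [|f g]; [apply: ga_supp0 | apply: suppD]. Qed.

Lemma supp_x S y : y \in S -> supp S (x y).
Proof.
by move=> hy z; rewrite (ga_co_x hV); have [<-|_] := eqVneq y z; rewrite ?eqxx.
Qed.

Lemma supp_ind S (P : V -> Prop) : P 0 ->
  (forall k y f, y \in S -> supp S f -> P f -> P (k *: x y + f)) ->
  forall f, supp S f -> P f.
Proof.
move=> P0 PS f hf; suff [] : supp S f /\ P f by [].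
have [s e] := ga_fin hV f; rewrite [X in supp S X]e [X in P X]e {e}.
elim: s => [|y s [hs Ps]]; first by rewrite big_nil; split => //; apply: ga_supp0.
(* The list [s] may contain points outside [S]; their coefficients vanish. *)
rewrite big_cons; have [->|hy] := eqVneq (co y f) 0.
  by rewrite scale0r add0r.
have hyS := hf y hy; split; last exact: PS.
by apply: suppD => //; apply/suppZ/supp_x.
Qed.

Lemma ga_ind (P : V -> Prop) : P 0 ->
  (forall k y f, P f -> P (k *: x y + f)) -> forall f, P f.
Proof. by move=> P0 PS f; apply: (@supp_ind predT) => // k y q _ _; apply: PS. Qed.

(** Linearity is asked for on F[S] only, because the metaplectic representation is specified only on
    F[Lam]. *)
Lemma supp_ext (U : lmodType F) S (A B : V -> U) : A 0 = 0 -> B 0 = 0 ->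
  (forall k f g, supp S f -> supp S g -> A (k *: f + g) = k *: A f + A g) ->
  (forall k f g, supp S f -> supp S g -> B (k *: f + g) = k *: B f + B g) ->
  (forall y, y \in S -> A (x y) = B (x y)) ->
  forall f, supp S f -> A f = B f.
Proof.
move=> A0 B0 hA hB h; apply: supp_ind => [|k y f hy hf IH]; first by rewrite A0 B0.
by rewrite hA ?hB ?h ?IH //; apply: supp_x.
Qed.

Lemma linear_supp S S' (A : V -> V) : A 0 = 0 ->
  (forall k f g, A (k *: f + g) = k *: A f + A g) ->
  (forall y, y \in S -> supp S' (A (x y))) -> forall f, supp S f -> supp S' (A f).
Proof.
move=> A0 hA h; apply: supp_ind => [|k y f hy hf IH].
  by rewrite A0; apply: ga_supp0.
by rewrite hA; apply: suppP => //; apply: h.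
Qed.

Lemma ga_mul0l g : mul 0 g = 0.
Proof.
have := ga_mulPl hV (-1) 0 0 g; rewrite scaler0 addr0 scaleN1r => ->.
by rewrite addNr.
Qed.

Lemma ga_mul0r f : mul f 0 = 0.
Proof.
have := ga_mulPr hV f (-1) 0 0; rewrite scaler0 addr0 scaleN1r => ->.
by rewrite addNr.
Qed.

Lemma ga_mulDl f f' g : mul (f + f') g = mul f g + mul f' g.
Proof. by rewrite -[f]scale1r (ga_mulPl hV) !scale1r. Qed.

Lemma ga_mulDr f g g' : mul f (g + g') = mul f g + mul f g'.
Proof. by rewrite -[g]scale1r (ga_mulPr hV) !scale1r. Qed.

Lemma ga_mulZl k f g : mul (k *: f) g = k *: mul f g.
Proof. by rewrite -[k *: f]addr0 (ga_mulPl hV) ga_mul0l addr0. Qed.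

Lemma ga_mulZr k f g : mul f (k *: g) = k *: mul f g.
Proof. by rewrite -[k *: g]addr0 (ga_mulPr hV) ga_mul0r addr0. Qed.

Lemma ga_mulNl f g : mul (- f) g = - mul f g.
Proof. by rewrite -scaleN1r ga_mulZl scaleN1r. Qed.

Lemma ga_mulNr f g : mul f (- g) = - mul f g.
Proof. by rewrite -scaleN1r ga_mulZr scaleN1r. Qed.

Lemma ga_mulBl f f' g : mul (f - f') g = mul f g - mul f' g.
Proof. by rewrite ga_mulDl ga_mulNl. Qed.

Lemma ga_mulBr f g g' : mul f (g - g') = mul f g - mul f g'.
Proof. by rewrite ga_mulDr ga_mulNr. Qed.

Lemma ga_mul_suml (I : Type) (s : seq I) (P : pred I) (G : I -> V) g :
  mul (\sum_(i <- s | P i) G i) g = \sum_(i <- s | P i) mul (G i) g.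
Proof. by apply: (big_morph (mul^~ g)) => [f f'|]; rewrite ?ga_mulDl ?ga_mul0l. Qed.

Lemma supp_mul S S' S'' f g :
  (forall y z, y \in S -> z \in S' -> y + z \in S'') ->
  supp S f -> supp S' g -> supp S'' (mul f g).
Proof.
move=> h hf hg; elim/(@supp_ind S): f / hf => [|k y f hy hf IH].
  by rewrite ga_mul0l; apply: ga_supp0.
rewrite (ga_mulPl hV); apply: suppP => //.
elim/(@supp_ind S'): g / hg {IH} => [|l z g hz hg IH].
  by rewrite ga_mul0r; apply: ga_supp0.
rewrite (ga_mulPr hV) (ga_mul_x hV); apply: suppP => //; apply: supp_x; exact: h.
Qed.

Lemma ga_mul_x0 f : mul f (x 0) = f.
Proof.
elim/ga_ind: f => [|k y f IH]; first exact: ga_mul0l.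
by rewrite (ga_mulPl hV) IH (ga_mul_x hV) addr0.
Qed.

Lemma co_mul_x q b y : co y (mul q (x b)) = co (y - b) q.
Proof.
elim/ga_ind: q => [|k z f IH].
  by rewrite ga_mul0l !ga_co0.
rewrite (ga_mulPl hV) !(ga_coP hV) (ga_mul_x hV) IH !(ga_co_x hV).
by rewrite -subr_eq opprK.
Qed.

(* The support of such a [q] would be stable under translation by [b]. *)
Lemma mul_binom_eq0 q b k1 k2 : b != 0 -> k1 != 0 -> k2 != 0 ->
  mul q (k1 *: x b + k2 *: x 0) = 0 -> q = 0.
Proof.
move=> b0 k10 k20 h.
have step z : co z q != 0 -> co (z - b) q != 0.
  apply: contra => /eqP e; have := congr1 (co z) h.
  rewrite (ga_mulPr hV) ga_mulZr ga_mul_x0 (ga_coP hV) co_mul_x e mulr0 add0r.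
  rewrite -[_ *: q]addr0 (ga_coP hV) ga_co0 addr0 => /eqP.
  by rewrite mulf_eq0 (negPf k20).
have [s es] := ga_fin hV q.
rewrite es big1 // => y _; suff -> : co y q = 0 by rewrite scale0r.
apply/eqP; apply: contraT => hy.
have hk n : co (y - b *+ n) q != 0.
  elim: n => [|n IH]; first by rewrite subr0.
  by rewrite mulrSr opprD addrA step.
have inj : injective (fun n : nat => y - b *+ n).
  move=> n m /addrI /oppr_inj /eqP; rewrite -!scaler_nat -subr_eq0 -scalerBl.
  by rewrite scaler_eq0 (negPf b0) orbF subr_eq0 eqr_nat => /eqP.
have hs z : co z q != 0 -> z \in s.
  apply: contraNT => hz; rewrite es.
  elim: s {es} hz => [|u s IH]; first by rewrite big_nil ga_co0.
  rewrite inE negb_or big_cons (ga_coP hV) => /andP [zu /IH /eqP ->].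
  by rewrite (ga_co_x hV) [u == z]eq_sym (negPf zu) mulr0 addr0.
pose t := [seq y - b *+ n | n <- iota 0 (size s).+1].
have : (size t <= size s)%N.
  apply: uniq_leq_size; first by rewrite map_inj_uniq // iota_uniq.
  by move=> z /mapP [n _ ->]; apply: hs.
by rewrite size_map size_iota ltnn.
Qed.

Lemma mul_binomB_eq0 q b : b != 0 -> mul q (x b - x 0) = 0 -> q = 0.
Proof.
move=> b0; rewrite -[x b]scale1r -scaleN1r => /(mul_binom_eq0 b0).
by apply; rewrite ?oppr_eq0 oner_eq0.
Qed.

Lemma mul_binom_inj q q' b : b != 0 ->
  mul q (x b - x 0) = mul q' (x b - x 0) -> q = q'.
Proof.
move=> b0 h; apply/eqP; rewrite -subr_eq0; apply/eqP/(mul_binomB_eq0 b0).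
by rewrite ga_mulBl h subrr.
Qed.

(** The abstract form of [gdiv]. By [quoP], any explicit witness is the chosen quotient when the
    denominator is x^b - 1 with b nonzero. *)
Definition quo f g : V := xget 0 [set q | mul q g = f]%classic.

Lemma quoP q b f : b != 0 -> mul q (x b - x 0) = f -> quo f (x b - x 0) = q.
Proof.
move=> b0 h; apply: xget_subset1 => // q1 q2 h1 h2.
by apply: (mul_binom_inj b0); rewrite h1 h2.
Qed.

Lemma quo0 b : b != 0 -> quo 0 (x 0 - x b) = 0.
Proof.
have key q : b != 0 -> mul q (x 0 - x b) = 0 -> q = 0.
  move=> b0; rewrite -opprB ga_mulNr => /eqP; rewrite oppr_eq0 => /eqP.
  exact: mul_binomB_eq0.
move=> b0; apply: xget_subset1 => [|q1 q2 h1 h2]; first exact: ga_mul0l.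
by rewrite (key q1 b0 h1) (key q2 b0 h2).
Qed.

(** A finite geometric sum along the line y + Zb. Both signs of [n] are needed, since al_i(y) can
    have either sign. *)
Lemma quo_geometric S y b (n : int) : (forall j : int, y + b *~ j \in S) ->
  exists2 q, supp S q & mul q (x b - x 0) = x (y + b *~ n) - x y.
Proof.
move=> hS; have step (j : int) : mul (x (y + b *~ j)) (x b - x 0) =
    x (y + b *~ (j + 1)) - x (y + b *~ j).
  by rewrite ga_mulBr !(ga_mul_x hV) addr0 mulrzDr addrA.
elim: n => [|n [q hq e]|n [q hq e]].
- by exists 0; [exact: ga_supp0 | rewrite ga_mul0l mulr0z addr0 subrr].
- exists (q + x (y + b *~ n)); first by apply/suppD/supp_x.
  by rewrite ga_mulDl e step [n%:Z + 1]addrC -intS [LHS]addrC addrA subrK.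
exists (q - x (y + b *~ (- n.+1%:Z))); first by apply/suppB/supp_x.
rewrite ga_mulBl e step (_ : - n.+1%:Z + 1 = - n%:Z); first by rewrite opprB addrC addrA subrK.
by rewrite intS opprD addrC addNKr.
Qed.

End GroupAlgebraTheory.

(** * Inversions, length and minimal coset representatives *)

Section WeylCombinatorics.
Variables (R : realType) (d : nat) (Phi : {fset 'rV[R]_d}).
Hypothesis hPhi : irreducible_root_system Phi.
Variables (r : nat) (Delta : r.-tuple 'rV[R]_d).
Hypothesis hDelta : is_base Phi Delta.
Variables (W : finGroupType) (rho : W -> 'M[R]_d).
Hypothesis hW : is_weyl_group rho Phi.
Implicit Types (a b : 'rV[R]_d) (u w : W) (i j : 'I_r) (t : seq 'I_r).

Local Notation s := (srefl rho Delta).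
Local Notation al := (tnth Delta).
Local Notation pos := (positive Delta).
Local Notation wprod t := (\prod_(i <- t) s i)%g.

Lemma simple_root i : al i \in Phi.
Proof. by case: hDelta. Qed.

Lemma root_neq0 a : a \in Phi -> a != 0.
Proof. exact: (rs_neq0 hPhi). Qed.

Lemma rhoK w : rho w *m rho w^-1%g = 1%:M.
Proof. by rewrite -(wg_M hW) mulgV (wg_1 hW). Qed.

Lemma rhoVK w : rho w^-1%g *m rho w = 1%:M.
Proof. by rewrite -(wg_M hW) mulVg (wg_1 hW). Qed.

(** At this stage W is only known to be generated by all reflections; generation by the simple ones
    is [has_wordP]. *)
Lemma rho_ind (P : W -> Prop) : P 1%g ->
  (forall a w, a \in Phi -> P w -> P (sref rho a * w)%g) -> forall w, P w.
Proof.
move=> P1 PM w.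
have : w \in <<[set:: [seq sref rho a | a <- Phi]]>>%g by rewrite (wg_gen hW) inE.
case/gen_prodgP => n [c hc ->].
elim: n c hc => [|n IH] c hc; first by rewrite big_ord0.
rewrite big_ord_recl.
have := hc ord0; rewrite inE => /mapP [a ha ->].
by apply: PM => //; apply: IH => i.
Qed.

Lemma rho_orth w : rho w *m (rho w)^T = 1%:M.
Proof.
elim/rho_ind: w => [|a w ha IH]; first by rewrite (wg_1 hW) trmx1 mulmx1.
rewrite (wg_M hW) (wg_refl hW) // trmx_mul mulmxA -(mulmxA (refl_mx a)) IH.
by rewrite mulmx1 refl_mx_tr refl_mxK // root_neq0.
Qed.

Lemma rho_tr w : (rho w)^T = rho w^-1%g.
Proof. by rewrite -[LHS]mul1mx -(rhoVK w) -mulmxA rho_orth mulmx1. Qed.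

Lemma coroot_rho a w : coroot (a *m rho w) = rho w^-1%g *m coroot a.
Proof. by rewrite coroot_orth ?rho_orth // rho_tr. Qed.

Lemma refl_mx_rho a w : refl_mx (a *m rho w) = rho w^-1%g *m refl_mx a *m rho w.
Proof. by rewrite refl_mx_orth ?rho_orth // rho_tr. Qed.

Lemma root_act w a : a \in Phi -> a *m rho w \in Phi.
Proof.
elim/rho_ind: w a => [|b w hb IH] a ha; first by rewrite (wg_1 hW) mulmx1.
rewrite (wg_M hW) (wg_refl hW) // mulmxA; apply: IH.
by rewrite row_refl; apply: (rs_refl hPhi).
Qed.

Lemma root_opp a : a \in Phi -> - a \in Phi.
Proof.
move=> ha; have := root_act (sref rho a) ha.
by rewrite (wg_refl hW) // row_refl_id // root_neq0.
Qed.

Lemma rho_srefl i : rho (s i) = refl_mx (al i).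
Proof. by rewrite (wg_refl hW) // simple_root. Qed.

Lemma sreflK i : (s i * s i = 1)%g.
Proof.
apply: (wg_inj hW); rewrite (wg_M hW) rho_srefl refl_mxK ?(wg_1 hW) //.
exact/root_neq0/simple_root.
Qed.

Lemma sreflV i : ((s i)^-1 = s i)%g.
Proof. by apply/eqP; rewrite eq_invg_mul sreflK. Qed.

Lemma sreflM i w : (s i * (s i * w) = w)%g.
Proof. by rewrite mulgA sreflK mul1g. Qed.

Lemma coordE i j : coord Delta i (al j) = (i == j)%:R.
Proof.
rewrite (tnth_nth 0) coord_free; last by case: hDelta.
by rewrite eq_sym.
Qed.

Lemma root_coord a : a \in Phi ->
  (forall i, 0 <= coord Delta i a) \/ (forall i, coord Delta i a <= 0).
Proof.
case: hDelta => _ _ h /h [k [->|->]]; [left|right] => i.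
  rewrite raddf_sum sumr_ge0 // => j _.
  by rewrite raddfMn /= coordE mulrn_wge0 // ler0n.
rewrite raddfN raddf_sum oppr_le0 sumr_ge0 // => j _.
by rewrite raddfMn /= coordE mulrn_wge0 // ler0n.
Qed.

Lemma coord_decomp a : a \in Phi -> a = \sum_i coord Delta i a *: al i.
Proof.
case: hDelta => _ _ h /h [k hk].
rewrite [LHS](@coord_span _ _ _ Delta) //.
  by apply: eq_bigr => i _; rewrite (tnth_nth 0).
have hs : \sum_i al i *+ k i \in <<Delta>>%VS.
  by apply: rpred_sum => i _; rewrite rpredMn // memv_span // mem_tnth.
by case: hk => ->; rewrite ?rpredN.
Qed.

Lemma pos_simple i : pos (al i).
Proof. by apply/forallP => j; rewrite coordE ler0n. Qed.

Lemma neg_pos a : a \in Phi -> pos (- a) = ~~ pos a.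
Proof.
move=> ha; apply/idP/idP => [/forallP hn|].
  apply/negP => /forallP hp; move/negP: (root_neq0 ha); apply; apply/eqP.
  rewrite (coord_decomp ha) big1 // => i _.
  have := hn i; rewrite raddfN oppr_ge0 => h.
  by have -> : coord Delta i a = 0; [apply/eqP; rewrite eq_le h hp | rewrite scale0r].
move=> hn; apply/forallP => i; rewrite raddfN oppr_ge0.
case: (root_coord ha) => h; last exact: h.
by case/negP: hn; apply/forallP => j; exact: h.
Qed.

Lemma coord_srefl i j a :
  coord Delta j (a *m rho (s i)) = coord Delta j a - ev a (coroot (al i)) * (j == i)%:R.
Proof. by rewrite rho_srefl row_refl raddfB /= linearZ /= coordE. Qed.

(** s_i changes only the i-th coordinate. If the image is negative, all other coordinates of [a]
    vanish, and a reduced system leaves only a = al_i. *)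
Lemma pos_refl i a : a \in Phi -> pos a -> a != al i -> pos (a *m rho (s i)).
Proof.
move=> ha hp hne; apply: contraNT hne => hn.
have hb := root_act (s i) ha.
have hneg : forall j, coord Delta j (a *m rho (s i)) <= 0.
  case: (root_coord hb) => h; last exact: h.
  by case/negP: hn; apply/forallP => j; exact: h.
have h0 j : j != i -> coord Delta j a = 0.
  move=> ji; have := hneg j.
  rewrite coord_srefl (negPf ji) mulr0 subr0 => h.
  by apply/eqP; rewrite eq_le h (forallP hp j).
have [k e] : exists k : R, a = k *: al i.
  exists (coord Delta i a).
  rewrite {1}(coord_decomp ha) (bigD1 i) //= big1 ?addr0 // => j ji.
  by rewrite h0 // scale0r.
rewrite e in ha hp *; case: (rs_reduced hPhi (simple_root i) ha) => ek.
  by rewrite ek scale1r.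
by have := forallP hp i; rewrite ek linearZ /= coordE eqxx mulr1 lerNr oppr0 ler10.
Qed.

Lemma refl_prop a b : a \in Phi -> b \in Phi -> refl_mx a = refl_mx b ->
  a = b \/ a = - b.
Proof.
move=> ha hb h; have [k e] := refl_mx_inj (root_neq0 ha) h.
rewrite e in ha *; case: (rs_reduced hPhi hb ha) => ->.
  by left; rewrite scale1r.
by right; rewrite scaleN1r.
Qed.

Lemma sref_act a w : a \in Phi -> sref rho (a *m rho w) = (w^-1 * sref rho a * w)%g.
Proof.
move=> ha; apply: (wg_inj hW); rewrite (wg_refl hW) ?root_act // !(wg_M hW).
by rewrite (wg_refl hW) // refl_mx_rho.
Qed.

(** Otherwise |a|^2 = sum of coord_i(a) (al_i, a) would be at most 0. *)
Lemma pos_descent a : a \in Phi -> pos a ->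
  exists i, 0 < ev a (coroot (al i)).
Proof.
move=> ha hp; apply/existsP; apply: contraT; rewrite negb_exists => /forallP hn.
have := sqnorm_gt0 (root_neq0 ha); rewrite ltNge => /negP; case.
rewrite /sqnorm [X in X *m _]coord_decomp // mulmx_suml summxE.
apply: sumr_le0 => i _; rewrite -scalemxAl mxE mulr_ge0_le0 //.
  exact: (forallP hp i).
have := hn i; rewrite -leNgt ev_coroot_inner pmulr_rle0; last first.
  by rewrite divr_gt0 // sqnorm_gt0 // root_neq0 // simple_root.
by rewrite (_ : a *m (al i)^T = (al i *m a^T)^T) ?mxE // trmx_mul trmxK.
Qed.

Lemma sref_word a : a \in Phi -> exists t, sref rho a = wprod t.
Proof.
(* Induction on a bound for the height of [b]: a simple reflection pairing positively with [b]
   lowers the height by at least 1 and conjugates the reflection. *)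
have key (n : nat) b : b \in Phi -> pos b -> \sum_i coord Delta i b <= n%:R ->
    exists t, sref rho b = wprod t.
  elim: n b => [|n IH] b hb hp hn.
    exfalso; move/negP: (root_neq0 hb); apply; apply/eqP.
    have /eqP : \sum_i coord Delta i b = 0.
      by apply/eqP; rewrite eq_le hn sumr_ge0 // => i _; exact: (forallP hp i).
    rewrite psumr_eq0 => [/allP h|i _]; last exact: (forallP hp i).
    rewrite (coord_decomp hb) big1 // => i _.
    by have /eqP -> := h i (mem_index_enum _); rewrite scale0r.
  have [i hi] := pos_descent hb hp.
  have [->|hne] := eqVneq b (al i); first by exists [:: i]; rewrite big_seq1.
  have hp' := pos_refl hb hp hne.
  have hb' := root_act (s i) hb.
  case: (IH _ hb' hp').
    have hint : 1 <= ev b (coroot (al i)).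
      have /intrP [m hm] := rs_int hPhi (simple_root i) hb.
      by move: hi; rewrite hm ltr0z ler1z.
    under eq_bigr do rewrite coord_srefl.
    rewrite sumrB lerBlDr (le_trans hn) // -natr1 lerD2l.
    rewrite (bigD1 i) //= eqxx mulr1 big1 ?addr0 // => j ji.
    by rewrite (negPf ji) mulr0.
  move=> t ht; exists (i :: rcons t i).
  rewrite big_cons big_rcons /=.
  by rewrite -ht sref_act // sreflV -(mulgA (s i * _)%g) sreflK mulg1 sreflM.
have bound (x : R) : exists n : nat, x <= n%:R.
  exists (Num.Def.archi_bound `|x|).
  exact: le_trans (ler_norm _) (ltW (archi_boundP (normr_ge0 x))).
move=> ha; have [hp|hp] := boolP (pos a).
  by have [n hn] := bound (\sum_i coord Delta i a); apply: key hn.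
have ha' := root_opp ha; have hp' : pos (- a) by rewrite neg_pos.
have [n hn] := bound (\sum_i coord Delta i (- a)).
have [t ht] := key n _ ha' hp' hn; exists t; rewrite -ht.
by apply: (wg_inj hW); rewrite !(wg_refl hW) // refl_mxN.
Qed.

Lemma has_wordP w : exists t, w = wprod t.
Proof.
elim/rho_ind: w => [|a w ha [t ->]]; first by exists [::]; rewrite big_nil.
by have [t' ->] := sref_word ha; exists (t' ++ t); rewrite big_cat.
Qed.

Local Notation inv := (inversion rho Delta).

Lemma act_rhoV w a : a *m rho w *m rho w^-1%g = a.
Proof. by rewrite -mulmxA rhoK mulmx1. Qed.

Lemma act_rhoVK w a : a *m rho w^-1%g *m rho w = a.
Proof. by rewrite -mulmxA rhoVK mulmx1. Qed.

Lemma simple_act_srefl i w : al i *m rho (s i * w)%g = - (al i *m rho w).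
Proof.
rewrite (wg_M hW) mulmxA rho_srefl row_refl_id ?mulNmx //.
exact/root_neq0/simple_root.
Qed.

Lemma pos_simple_srefl i w : pos (al i *m rho (s i * w)%g) = ~~ pos (al i *m rho w).
Proof. by rewrite simple_act_srefl neg_pos // root_act // simple_root. Qed.

(** With b = w a, the reflection s_i changes the sign of b only for b = al_i or b = -al_i; the
    latter makes [a] negative, so exactly one inversion is added. *)
Lemma inversion_srefl i w a : a \in Phi -> pos (al i *m rho w) ->
  inv (s i * w)%g a = inv w a || (a == al i *m rho w).
Proof.
move=> ha hp; rewrite /inversion invMg sreflV (wg_M hW) mulmxA.
have hb := root_act w^-1 ha; have hbs := root_act (s i) hb.
rewrite !neg_pos //; set b := a *m rho w^-1%g.
have ea : a = b *m rho w by rewrite act_rhoVK.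
have [e|ne] := eqVneq b (al i).
  rewrite ea e eqxx orbT rho_srefl row_refl_id ?root_neq0 ?simple_root //.
  by rewrite neg_pos ?simple_root // pos_simple negbK andbT.
have -> : (a == al i *m rho w) = false.
  apply: contraNF ne => /eqP; rewrite ea => /(congr1 (mulmx^~ (rho w^-1%g))).
  by rewrite !act_rhoV => ->.
rewrite orbF.
have [e|ne'] := eqVneq b (- al i).
  have -> : pos a = false; last by [].
  by apply/negbTE; rewrite -neg_pos // ea e mulNmx opprK.
congr (_ && ~~ _).
have [hpb|hnb] := boolP (pos b); first by rewrite pos_refl.
apply/negbTE; rewrite -neg_pos // -mulNmx pos_refl ?root_opp ?neg_pos //.
by apply: contraNneq ne' => <-; rewrite opprK.
Qed.

(** The operation is arbitrary because two cases occur: the sum of ones gives the length, and the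
    product of the Gauss parameters gives the recursion of [hfun]. *)
Lemma big_inversion_srefl (S : Type) (idx : S) (op : Monoid.com_law idx)
    (F : 'rV[R]_d -> S) i w : pos (al i *m rho w) ->
  \big[op/idx]_(a <- Phi | inv (s i * w)%g a) F a =
  op (F (al i *m rho w)) (\big[op/idx]_(a <- Phi | inv w a) F a).
Proof.
move=> hp; set b := al i *m rho w.
have hb : b \in Phi by rewrite root_act // simple_root.
rewrite -big_filter (bigD1_seq b) ?filter_uniq ?fset_uniq //=; last first.
  by rewrite mem_filter inversion_srefl // eqxx orbT.
congr (op _ _); rewrite big_filter_cond [in LHS]big_seq_cond [in RHS]big_seq_cond.
apply: eq_bigl => a; have [ha|//] := boolP (a \in Phi).
rewrite /= inversion_srefl //.
have [->|_] := eqVneq a b; last by rewrite orbF andbT.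
by rewrite andbF /inversion act_rhoV neg_pos ?simple_root // pos_simple andbF.
Qed.

(** Counting inversions gives a length with an exact recursion; [wlenE] identifies it with the
    search over words in [wlen]. *)
Definition ninv w : nat := (\sum_(a <- Phi | inv w a) 1)%N.

Lemma ninv1 : ninv 1%g = 0%N.
Proof.
rewrite /ninv big_seq_cond big1 // => a /andP [ha].
by rewrite /inversion invg1 (wg_1 hW) mulmx1 neg_pos // andbN.
Qed.

Lemma ninvS i w : pos (al i *m rho w) -> ninv (s i * w)%g = (ninv w).+1.
Proof. by move=> h; rewrite /ninv big_inversion_srefl. Qed.

Lemma ninvP i w : ~~ pos (al i *m rho w) -> ninv w = (ninv (s i * w)%g).+1.
Proof.
move=> h; rewrite -[in LHS](sreflM i w) ninvS //.
by rewrite pos_simple_srefl.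
Qed.

Lemma ninv_word t : (ninv (wprod t) <= size t)%N.
Proof.
elim: t => [|i t IH]; first by rewrite big_nil ninv1.
rewrite big_cons /=; have [h|h] := boolP (pos (al i *m rho (wprod t))).
  by rewrite ninvS.
by rewrite -ltnS -ninvP // (leq_trans IH) // -addn2 leq_addr.
Qed.

(* The root [al i] turns negative along the word; the letter at which this
   happens is the one that [s i] deletes. *)
Lemma exchange i t : ~~ pos (al i *m rho (wprod t)) ->
  exists t1 j t2, t = t1 ++ j :: t2 /\ (s i * wprod t = wprod (t1 ++ t2))%g.
Proof.
elim/last_ind: t => [|t j IH]; first by rewrite big_nil (wg_1 hW) mulmx1 pos_simple.
rewrite big_rcons /= (wg_M hW) mulmxA => hn.
have [h|h] := boolP (pos (al i *m rho (wprod t))); last first.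
  have [t1 [k [t2 [-> e]]]] := IH h; exists t1, k, (rcons t2 j).
  rewrite -cats1 -catA /= cats1; split => //.
  by rewrite mulgA e -rcons_cat big_rcons.
exists t, j, [::]; rewrite cats1 cats0; split => //.
have hb : al i *m rho (wprod t) \in Phi by rewrite root_act // simple_root.
have e : al i *m rho (wprod t) = al j.
  by apply/eqP; apply: contraNT hn => hne; apply: pos_refl.
have := sref_act (wprod t) (simple_root i).
rewrite e -/(s j) => ->.
by rewrite -/(s i) -(mulgA _^-1%g) mulKVg sreflM.
Qed.

(** A first letter that fails to raise [ninv] cancels a later letter by exchange, which leaves a
    shorter word for the same element. *)
Lemma word_ninv w : exists2 t, size t = ninv w & w = wprod t.
Proof.
have key n t : (size t <= n)%N -> exists2 t', size t' = ninv (wprod t) & wprod t = wprod t'.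
  elim: n t => [|n IH] [|i t] //= hs; try by exists [::]; rewrite ?big_nil ?ninv1.
  have [h|h] := boolP (pos (al i *m rho (wprod t))).
    have [t' st et] := IH t hs; exists (i :: t'); rewrite !big_cons -?et //=.
    by rewrite ninvS // st.
  have [t1 [j [t2 [et e]]]] := exchange h.
  rewrite big_cons e; apply: IH; apply: leq_trans (hs : (size t <= n)%N).
  by rewrite et !size_cat /= addnS.
by have [t ->] := has_wordP w; apply: (key (size t)).
Qed.

(** [wlen] searches only below #|W|, so this bound is what makes the search succeed. Suffixes of a
    reduced word realize every value up to [ninv w], hence [ninv w] + 1 distinct elements. *)
Lemma ninv_lt w : (ninv w < #|W|)%N.
Proof.
have key n u : ninv u = n -> forall k, (k <= n)%N -> exists u', ninv u' = k.
  elim: n u => [|n IH] u hu k hk; first by exists u; case: k hk.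
  have [t st et] := word_ninv u; case: t st et => [|i t] st et.
    by rewrite hu in st.
  have hu' : ninv (wprod t) = n.
    move: (ninv_word t) => /= h1; rewrite hu in st; case: st => st.
    have [h|h] := boolP (pos (al i *m rho (wprod t))).
      by have := ninvS h; move: et; rewrite big_cons => <-; rewrite hu => -[].
    have := ninvP h; move: et; rewrite big_cons => <-; rewrite hu => h2.
    by move: h1; rewrite h2 st ltnNge leqnSn.
  move: hk; rewrite leq_eqVlt => /predU1P [->|]; first by exists u.
  by rewrite ltnS => hk; apply: (IH (wprod t)).
have f_ex (k : 'I_(ninv w).+1) : exists u', ninv u' == k.
  by have [u' <-] := key _ w erefl k (ltn_ord k); exists u'.
rewrite -[X in (X <= _)%N]card_ord.
apply: (@leq_card _ _ (fun k => xchoose (f_ex k))) => k k' e.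
apply/val_inj => /=.
by rewrite -(eqP (xchooseP (f_ex k))) -(eqP (xchooseP (f_ex k'))) e.
Qed.

Lemma wlenE w : wlen rho Delta w = ninv w.
Proof.
rewrite /wlen; have hn := ninv_lt w.
have hw : has_word rho Delta w (ninv w).
  have [t st et] := word_ninv w; apply/existsP.
  by exists (tcast st (in_tuple t)); rewrite val_tcast /= et.
have hfind : (find (has_word rho Delta w) (iota 0 #|W|) <= ninv w)%N.
  rewrite leqNgt; apply/negP => h.
  by have := before_find 0%N h; rewrite nth_iota // hw.
apply/eqP; rewrite eqn_leq hfind /=.
have hlt : (find (has_word rho Delta w) (iota 0 #|W|) < #|W|)%N.
  exact: leq_ltn_trans hfind hn.
have : has (has_word rho Delta w) (iota 0 #|W|) by rewrite has_find size_iota.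
move/(nth_find 0%N); rewrite nth_iota // add0n => /existsP [t /eqP et].
rewrite -[X in (_ <= X)%N](size_tuple t) -[X in ninv X]et; exact: ninv_word.
Qed.

Local Notation len := (wlen rho Delta).

Lemma len1 : len 1%g = 0%N. Proof. by rewrite wlenE ninv1. Qed.

Lemma len_word t : (len (wprod t) <= size t)%N.
Proof. by rewrite wlenE ninv_word. Qed.

Lemma lenS i w : pos (al i *m rho w) -> len (s i * w)%g = (len w).+1.
Proof. by rewrite !wlenE; apply: ninvS. Qed.

Lemma lenP i w : ~~ pos (al i *m rho w) -> len w = (len (s i * w)%g).+1.
Proof. by rewrite !wlenE; apply: ninvP. Qed.

Lemma pos_len i w : pos (al i *m rho w) = (len w < len (s i * w)%g)%N.
Proof.
have [h|h] := boolP (pos _); first by rewrite lenS // ltnSn.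
by rewrite (lenP h) ltnNge leqnSn.
Qed.

Lemma lenV w : len w^-1%g = len w.
Proof.
have key u : (len u^-1%g <= len u)%N.
  have [t st et] := word_ninv u; rewrite (wlenE u) -st et.
  rewrite (_ : (wprod t)^-1%g = wprod (rev t)) ?(leq_trans (len_word _)) ?size_rev //.
  elim: t {st et} => [|i t IH]; first by rewrite big_nil invg1.
  by rewrite rev_cons big_rcons big_cons invMg IH sreflV.
by apply/eqP; rewrite eqn_leq key -[X in (len X <= _)%N]invgK key.
Qed.

Lemma lenSr i w : pos (al i *m rho w^-1%g) -> len (w * s i)%g = (len w).+1.
Proof. by move=> h; rewrite -lenV invMg sreflV lenS // lenV. Qed.

Lemma lenPr i w : ~~ pos (al i *m rho w^-1%g) -> len w = (len (w * s i)%g).+1.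
Proof. by move=> h; rewrite -lenV (lenP h) -[in RHS]lenV invMg sreflV. Qed.

Lemma len_eq0 w : len w = 0%N -> w = 1%g.
Proof.
rewrite wlenE => h; have [t st ->] := word_ninv w.
by move: st; rewrite h => /size0nil ->; rewrite big_nil.
Qed.

Lemma len_le_srefl i w : (len (s i * w)%g <= (len w).+1)%N.
Proof.
have [h|h] := boolP (pos (al i *m rho w)); first by rewrite lenS.
by rewrite (lenP h) -addn2 leq_addr.
Qed.

Lemma len_ind (P : W -> Prop) : P 1%g ->
  (forall i w, pos (al i *m rho w) -> P w -> P (s i * w)%g) -> forall w, P w.
Proof.
move=> P1 PS w; have [n] := ubnP (len w); elim: n w => // n IH w.
have [t st et] := word_ninv w; case: t st et => [|i t] st et.
  by rewrite et big_nil.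
have e : (s i * w = wprod t)%g by rewrite et big_cons sreflM.
have hn : ~~ pos (al i *m rho w).
  by rewrite pos_len e -leqNgt (leq_trans (len_word _)) // wlenE -st leqnSn.
rewrite (lenP hn) !ltnS => hl; rewrite -(sreflM i w).
by apply: PS; [rewrite pos_simple_srefl | apply: IH].
Qed.

Lemma pos_sum a w : a \in Phi -> pos a ->
  (forall i, coord Delta i a != 0 -> pos (al i *m rho w)) -> pos (a *m rho w).
Proof.
move=> ha /forallP hp h; apply/forallP => j.
rewrite {1}(coord_decomp ha) mulmx_suml raddf_sum sumr_ge0 //= => i _.
rewrite -scalemxAl linearZ /=; have [->|hi] := eqVneq (coord Delta i a) 0.
  by rewrite mul0r.
by rewrite mulr_ge0 // (forallP (h i hi) j).
Qed.

(** * The longest element *)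

Local Notation w0 := (longest rho Delta).

Lemma len_longest w : (len w <= len w0)%N.
Proof. by rewrite /longest; case: arg_maxnP => // u _; apply. Qed.

Lemma longest_neg i : ~~ pos (al i *m rho w0).
Proof. by apply/negP => h; have := len_longest (s i * w0)%g; rewrite lenS // ltnn. Qed.

Lemma neg_act w a : (forall i, ~~ pos (al i *m rho w)) -> a \in Phi ->
  pos (a *m rho w) = ~~ pos a.
Proof.
move=> h; have hn b : b \in Phi -> pos b -> ~~ pos (b *m rho w).
  move=> hb hp; rewrite -neg_pos ?root_act //; apply/forallP => j.
  rewrite {1}(coord_decomp hb) mulmx_suml -sumrN raddf_sum sumr_ge0 //= => i _.
  rewrite -scalemxAl -scalerN linearZ /= mulr_ge0 //; first exact: (forallP hp i).
  have := h i; rewrite -neg_pos ?root_act ?simple_root // => /forallP; exact.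
move=> ha; apply/idP/idP => [|hna]; first exact/contraTN/hn.
rewrite -[a]opprK mulNmx neg_pos ?root_act ?root_opp //.
by rewrite hn ?root_opp ?neg_pos.
Qed.

Lemma longestK : (w0 * w0 = 1)%g.
Proof.
apply: len_eq0; rewrite wlenE /ninv big_seq_cond big1 // => a /andP [ha].
rewrite /inversion neg_pos ?root_act //.
have hn := neg_act longest_neg.
have -> : pos (a *m rho (w0 * w0)^-1%g) = pos a; last by rewrite andbN.
rewrite -[a in RHS](act_rhoVK (w0 * w0)%g) (wg_M hW w0) mulmxA.
by rewrite !hn ?root_act // negbK.
Qed.

Lemma longestV : (w0^-1 = w0)%g.
Proof. by apply/eqP; rewrite eq_invg_mul longestK. Qed.

Lemma longest_uniq w : (forall i, ~~ pos (al i *m rho w)) -> w = w0.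
Proof.
move=> h; suff e : (w * w0 = 1)%g by rewrite -[w]mulg1 -longestK mulgA e mul1g.
apply: len_eq0; rewrite wlenE /ninv big_seq_cond big1 // => a /andP [ha].
rewrite /inversion neg_pos ?root_act //.
have -> : pos (a *m rho (w * w0)^-1%g) = pos a; last by rewrite andbN.
rewrite -[a in RHS](act_rhoVK (w * w0)%g) (wg_M hW w) mulmxA.
by rewrite (neg_act longest_neg) ?root_act // (neg_act h) ?root_act // negbK.
Qed.

(** Each positive root is an inversion of exactly one of [w] and w0 w, because w0 exchanges positive
    and negative roots. *)
Lemma len_longestM w : (len (w0 * w)%g + len w)%N = len w0.
Proof.
have key u : (ninv (w0 * u)%g + ninv u = \sum_(a <- Phi | pos a) 1)%N.
  rewrite (bigID (fun a => pos (a *m rho u^-1%g))) /= /ninv; congr addn.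
    rewrite big_seq_cond [RHS]big_seq_cond; apply: eq_bigl => a.
    have [ha|//] := boolP (a \in Phi).
    rewrite /inversion neg_pos ?root_act // invMg longestV (wg_M hW) mulmxA.
    by rewrite (neg_act longest_neg) ?root_act // negbK.
  rewrite big_seq_cond [RHS]big_seq_cond; apply: eq_bigl => a.
  by have [ha|//] := boolP (a \in Phi); rewrite /inversion neg_pos ?root_act.
by rewrite !wlenE key -(key 1%g) mulg1 ninv1 addn0.
Qed.

(** The conjugate of s_i has length l(w0) - l(s_i w0) = 1, so it is simple; its root is al_i w0 up
    to sign, and the sign is forced because al_i w0 is negative. *)
Lemma longest_simple i : exists2 j, (s j = w0 * s i * w0)%g & al j = - (al i *m rho w0).
Proof.
have hl : len (w0 * s i * w0)%g = 1%N.
  have e1 := len_longestM (s i * w0)%g; have e2 := lenP (longest_neg i).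
  rewrite -mulgA; apply/eqP; rewrite -(eqn_add2r (len (s i * w0)%g)) e1 e2.
  by rewrite add1n.
have [t st et] := word_ninv (w0 * s i * w0)%g.
rewrite -wlenE hl in st; case: t st et => [|j [|//]] // _; rewrite big_seq1 => ej.
exists j => //; have hb : al i *m rho w0 \in Phi by rewrite root_act ?simple_root.
have : refl_mx (al j) = refl_mx (al i *m rho w0).
  by rewrite refl_mx_rho -!rho_srefl -ej longestV !(wg_M hW).
case/(refl_prop (simple_root j) hb) => // e.
by have := longest_neg i; rewrite -e pos_simple.
Qed.

(** * Stabilizers of dominant points and minimal coset representatives *)

Lemma stabM (c : 'cV[R]_d) u w :
  u \in stab rho c -> (rho (w * u)%g *m c = rho w *m c).
Proof. by rewrite inE (wg_M hW) -mulmxA => /eqP ->. Qed.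

Lemma stab1 (c : 'cV[R]_d) : 1%g \in stab rho c.
Proof. by rewrite inE (wg_1 hW) mul1mx. Qed.

Lemma in_stabM (c : 'cV[R]_d) u w :
  u \in stab rho c -> w \in stab rho c -> (u * w)%g \in stab rho c.
Proof. by move=> hu hw; move: (hu); rewrite !inE stabM. Qed.

Lemma in_stabV (c : 'cV[R]_d) u : u \in stab rho c -> u^-1%g \in stab rho c.
Proof.
by rewrite !inE => /eqP h; rewrite -{1}h mulmxA rhoVK mul1mx.
Qed.

Lemma stabP (c : 'cV[R]_d) u w :
  rho u *m c = rho w *m c -> (w^-1 * u)%g \in stab rho c.
Proof. by move=> h; rewrite inE (wg_M hW) -mulmxA h mulmxA rhoVK mul1mx. Qed.

Lemma srefl_stab (c : 'cV[R]_d) i : ev (al i) c = 0 -> s i \in stab rho c.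
Proof. by move=> h; rewrite inE rho_srefl refl_mxE h scale0r subr0. Qed.

Section Dominant.
Variable c : 'cV[R]_d.
Hypothesis hdom : forall a, a \in Phi -> pos a -> 0 <= ev a c.

Lemma simple_perp a i : a \in Phi -> pos a -> ev a c = 0 ->
  coord Delta i a != 0 -> ev (al i) c = 0.
Proof.
move=> ha hp; rewrite {1}(coord_decomp ha) ev_suml => /eqP.
rewrite psumr_eq0 => [/allP h hi|j _]; last first.
  by rewrite evZl mulr_ge0 ?(forallP hp j) // hdom ?simple_root ?pos_simple.
have := h i (mem_index_enum _); rewrite /= evZl mulf_eq0 (negPf hi) /=.
by move/eqP.
Qed.

Lemma descent_exists u : u != 1%g -> exists i, ~~ pos (al i *m rho u^-1%g).
Proof.
move=> h; apply/existsP; apply: contraNT h; rewrite negb_exists => /forallP h.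
have hp i : pos (al i *m rho u^-1%g) by have := h i; rewrite negbK.
apply/eqP/invg_inj; rewrite invg1; apply: len_eq0.
have [t st et] := word_ninv u^-1%g; rewrite wlenE -st; case: t st et => // i t st et.
have := hp i; rewrite pos_len ltnNge => /negP; case.
rewrite [in X in (X <= _)%N]et big_cons sreflM (leq_trans (len_word _)) //.
by rewrite wlenE -st leqnSn.
Qed.

(** The stabilizer of a dominant point is a standard parabolic subgroup. If al_i is a right descent
    of [u], the negative root al_i u^{-1} takes the value al_i(c) at c, since [u] fixes c; so
    al_i(c) is both at most and at least 0. *)
Lemma stab_ind (P : W -> Prop) : P 1%g ->
  (forall u i, u \in stab rho c -> ev (al i) c = 0 -> pos (al i *m rho u^-1%g) ->
    P u -> P (u * s i)%g) ->
  forall u, u \in stab rho c -> P u.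
Proof.
move=> P1 PS u; have [n] := ubnP (len u); elim: n u => // n IH u hl hu.
have [->//|/descent_exists [i hi]] := eqVneq u 1%g.
have hb : al i *m rho u^-1%g \in Phi by rewrite root_act ?simple_root.
have h0 : ev (al i) c = 0.
  apply/eqP; rewrite eq_le hdom ?simple_root ?pos_simple // andbT.
  have := hdom (root_opp hb); rewrite neg_pos // hi => /(_ isT).
  have /eqP e : rho u^-1%g *m c == c by have := in_stabV hu; rewrite inE.
  by rewrite -mulNmx -ev_mul e -scaleN1r evZl mulN1r oppr_ge0.
have hus : (u * s i)%g \in stab rho c by rewrite in_stabM // srefl_stab.
have e : (u * s i * s i = u)%g by rewrite -mulgA sreflK mulg1.
rewrite -e; apply: PS => //.
  rewrite invMg sreflV pos_simple_srefl //.
by apply: IH => //; move: hl; rewrite (lenPr hi).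
Qed.

Local Notation Wc := (min_coset_reps rho Delta c).

(** The positive root al_i u^{-1} vanishes at c, hence involves only simple roots vanishing at c,
    which [w] keeps positive. So each letter of [u] still raises the length after [w] is put in
    front. *)
Lemma len_parabolic w :
  (forall i, ev (al i) c = 0 -> pos (al i *m rho w^-1%g)) ->
  forall u, u \in stab rho c -> len (w * u)%g = (len w + len u)%N.
Proof.
move=> hw; apply: stab_ind => [|u i hu hi hp IH]; first by rewrite mulg1 len1 addn0.
rewrite mulgA [in RHS]lenSr // addnS -IH lenSr // invMg (wg_M hW) mulmxA.
have hb : al i *m rho u^-1%g \in Phi by rewrite root_act ?simple_root.
apply: pos_sum => // j hj; apply: hw; apply: simple_perp hj => //.
by rewrite -ev_mul; have := in_stabV hu; rewrite inE => /eqP ->.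
Qed.

Lemma min_repP w : reflect
  (forall i, ev (al i) c = 0 -> pos (al i *m rho w^-1%g)) (w \in Wc).
(* Only the simple reflections of W_c have to be tested, because lengths add along W_c; this local
   criterion is easy to follow under left multiplication by s_i. *)
Proof.
apply: (iffP idP) => [|h]; rewrite inE.
  move=> /forallP h i hi; rewrite -[pos _]negbK; apply/negP => hn.
  have := h (s i); rewrite srefl_stab //= => h'.
  by have := lenPr hn => e; rewrite e ltnn in h'.
apply/forallP => u; apply/implyP => hu; rewrite len_parabolic //.
exact: leq_addr.
Qed.

Lemma len_min_rep w u : w \in Wc -> u \in stab rho c ->
  len (w * u)%g = (len w + len u)%N.
Proof. by move/min_repP => h; apply: len_parabolic. Qed.

Lemma min_rep_exists x : exists w u, [/\ w \in Wc, u \in stab rho c & x = (w * u)%g].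
Proof.
pose u0 := [arg min_(u < 1%g in stab rho c) len (x * u)%g].
have [hu0 hmin] : u0 \in stab rho c /\
    forall u, u \in stab rho c -> (len (x * u0) <= len (x * u))%N.
  by rewrite /u0; case: arg_minnP => [|u hu h]; [exact: stab1 | split].
exists (x * u0)%g, u0^-1%g; split; last by rewrite mulgK.
  rewrite inE; apply/forallP => u; apply/implyP => hu.
  by rewrite -mulgA hmin // in_stabM.
exact: in_stabV.
Qed.

Lemma min_rep_uniq w w' : w \in Wc -> w' \in Wc ->
  rho w *m c = rho w' *m c -> w = w'.
Proof.
move=> hw hw' /stabP hu.
have e1 := len_min_rep hw' hu; have e2 := len_min_rep hw (in_stabV hu).
rewrite mulKVg in e1; rewrite invMg invgK mulKVg in e2.
have : len (w'^-1 * w)%g = 0%N.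
  by apply/eqP; rewrite -leqn0 -(leq_add2l (len w')) -e1 addn0 e2 leq_addr.
by move/len_eq0/eqP; rewrite -eq_mulVg1 => /eqP.
Qed.

Lemma sum_min_rep (V : zmodType) (F : W -> V) :
  \sum_(x in [set: W]) F x = \sum_(w in Wc) \sum_(u in stab rho c) F (w * u)%g.
Proof.
pose h (p : W * W) := (p.1 * p.2)%g.
have h_inj : {in finset.setX Wc (stab rho c) &, injective h}.
  move=> [w u] [w' u'] /finset.setXP [/= hw hu] /finset.setXP [/= hw' hu'] e.
  have ew : w = w'.
    by apply: min_rep_uniq => //; rewrite -(stabM w hu) -(stabM w' hu') [(w * u)%g]e.
  by move: e; rewrite /h /= ew => /mulgI ->.
transitivity (\sum_(x in [set h p | p in finset.setX Wc (stab rho c)]) F x).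
  apply: eq_bigl => x; rewrite inE; symmetry; apply/imsetP.
  have [w [u [hw hu ->]]] := min_rep_exists x.
  by exists (w, u) => //; rewrite finset.in_setX hw.
rewrite big_imset // pair_big /=; apply: eq_bigl => -[w u].
by rewrite finset.in_setX.
Qed.

Definition stab_longest : W := [arg max_(u > 1%g in stab rho c) len u].
Local Notation u0 := stab_longest.

Lemma stab_longestP : u0 \in stab rho c /\
  forall u, u \in stab rho c -> (len u <= len u0)%N.
Proof. by rewrite /u0; case: arg_maxnP => [|u hu h]; [exact: stab1 | split]. Qed.

Lemma srefl_min_rep_down w i : w \in Wc -> ~~ pos (al i *m rho w) -> (s i * w)%g \in Wc.
Proof.
move=> /min_repP hw hn; apply/min_repP => j hj.
rewrite invMg sreflV (wg_M hW) mulmxA.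
have hb := root_act w^-1 (simple_root j); apply: pos_refl => //; first exact: hw.
by apply: contraNneq hn => <-; rewrite act_rhoVK pos_simple.
Qed.

(** Deodhar's dichotomy: if minimality of s_i w fails at al_j, then al_j w^{-1} = al_i, so that s_i
    w = w s_j lies in w W_c and s_i w c = w c. *)
Lemma srefl_min_rep_up w i : w \in Wc -> pos (al i *m rho w) ->
  rho (s i * w)%g *m c != rho w *m c -> (s i * w)%g \in Wc.
Proof.
move=> /min_repP hw hp hne; apply/min_repP => j hj.
rewrite invMg sreflV (wg_M hW) mulmxA.
have hb := root_act w^-1 (simple_root j); apply: pos_refl => //; first exact: hw.
apply: contraNneq hne => e.
have := sref_act w^-1%g (simple_root j); rewrite e -!/(srefl rho Delta _) => ->.
by rewrite invgK mulgKV stabM // srefl_stab.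
Qed.

(** No s_i lengthens w u0: if s_i raises [w], then s_i w u0 stays in w W_c, where w u0 is longest;
    if s_i lowers [w], then s_i w is again minimal and lengths add. *)
Lemma min_rep_top w : w \in Wc ->
  (forall i, pos (al i *m rho w) -> rho (s i * w)%g *m c = rho w *m c) ->
  (w * u0 = w0)%g.
Proof.
move=> hw h; have [hu0 hmax] := stab_longestP.
apply: longest_uniq => i; rewrite pos_len -leqNgt mulgA.
have [hp|hn] := boolP (pos (al i *m rho w)).
  have /stabP hu := h i hp.
  have hu' := in_stabM hu hu0.
  have -> : (s i * w * u0 = w * (w^-1 * (s i * w) * u0))%g by rewrite -!mulgA mulKVg.
  by rewrite (len_min_rep hw hu') (len_min_rep hw hu0) leq_add2l hmax.
rewrite (len_min_rep (srefl_min_rep_down hw hn) hu0) (len_min_rep hw hu0) leq_add2r.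
by rewrite (lenP hn) leqnSn.
Qed.

Lemma len_min_rep_top w w' : w \in Wc -> (w * u0 = w0)%g -> w' \in Wc ->
  w' != w -> (len w' < len w)%N.
Proof.
move=> hw e hw' hne; have [hu0 _] := stab_longestP.
rewrite -(ltn_add2r (len u0)) -!len_min_rep // e ltn_neqAle len_longest andbT.
apply: contraNneq hne => hl; have : (w' * u0 = w0)%g.
  apply: longest_uniq => i; rewrite pos_len -leqNgt hl; exact: len_longest.
by rewrite -e => /mulIg ->.
Qed.

End Dominant.

Lemma lenM u w : (len (u * w)%g <= len u + len w)%N.
Proof.
have [t st et] := word_ninv u; have [t' st' et'] := word_ninv w.
rewrite {1}et {1}et' -big_cat (leq_trans (len_word _)) //.
by rewrite size_cat st st' !wlenE leqnn.
Qed.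

(** * Matsumoto's theorem *)

Section Matsumoto.
Variables (F : fieldType) (A : algType F) (T : 'I_r -> A).
Hypothesis braid : forall i j, let k := #[(s i * s j)%g]%g in
  alt_prod k (T i) (T j) = alt_prod k (T j) (T i).

Local Notation tprod t := (\prod_(i <- t) T i).

Definition reduced t := len (wprod t) == size t.

Fixpoint altw m i j : seq 'I_r := if m is m'.+1 then i :: altw m' j i else [::].

Lemma size_altw m i j : size (altw m i j) = m.
Proof. by elim: m i j => //= m IH i j; rewrite IH. Qed.

Lemma altw_prod m i j : tprod (altw m i j) = alt_prod m (T i) (T j).
Proof. by elim: m i j => [|m IH] i j; rewrite ?big_nil // big_cons IH. Qed.

Lemma altw_cat m n i j : exists t, altw (m + n) i j = altw m i j ++ t.
Proof.
elim: m i j => [|m IH] i j; first by exists (altw n i j).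
by have [t e] := IH j i; exists t; rewrite addSn /= e.
Qed.

Lemma altw_order m i j :
  (wprod (altw m i j) * (wprod (altw m j i))^-1 = (s i * s j) ^+ m)%g.
Proof.
elim: m i j => [|m IH] i j; first by rewrite !big_nil invg1 mulg1 expg0.
rewrite /= !big_cons invMg sreflV mulgA -(mulgA (s i)) IH.
elim: m {IH} => [|m IH]; first by rewrite expg0 mulg1 expg1.
by rewrite expgSr [RHS]expgSr -IH !mulgA.
Qed.

Lemma reduced_cat t1 t2 : reduced (t1 ++ t2) -> reduced t1 /\ reduced t2.
Proof.
rewrite /reduced size_cat big_cat /= => /eqP h.
have h1 := len_word t1; have h2 := len_word t2.
have := lenM (wprod t1) (wprod t2); rewrite h => h3.
split; rewrite eqn_leq ?h1 ?h2 /=.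
  by rewrite -(leq_add2r (size t2)) (leq_trans h3) // leq_add2l.
by rewrite -(leq_add2l (size t1)) (leq_trans h3) // leq_add2r.
Qed.

Lemma reduced_cons_neg i t : reduced (i :: t) -> ~~ pos (al i *m rho (wprod (i :: t))).
Proof.
move=> /eqP h; rewrite pos_len -leqNgt h big_cons sreflM.
by rewrite (leq_trans (len_word t)) //= leqnSn.
Qed.

Lemma reduced_eq t t' : wprod t = wprod t' -> size t = size t' ->
  reduced t -> reduced t'.
Proof. by rewrite /reduced => -> ->. Qed.

(** Equality of the two products means that the order k of s_i s_j divides [m], while reducedness
    gives m <= k. Only m = 0 and the braid relation m = k remain. *)
Lemma alternating_eq m i j : reduced (altw m i j) ->
  wprod (altw m i j) = wprod (altw m j i) ->
  tprod (altw m i j) = tprod (altw m j i).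
Proof.
move=> hr e; set k := #[(s i * s j)%g]%g.
have kpos : (0 < k)%N by apply: order_gt0.
have dvd : (k %| m)%N by rewrite order_dvdn -altw_order e mulgV.
have [->|m0] := posnP m; first by rewrite !big_nil.
(* The two alternating words of length k agree, so in one of length k + 1 the tail can be rewritten
   to start with the first letter, and the two cancel. *)
have : (m <= k)%N.
  rewrite leqNgt; apply/negP => hk.
  have [t et] := altw_cat k.+1 (m - k.+1) i j; rewrite subnKC // in et.
  rewrite et in hr; have [/eqP] := reduced_cat hr.
  have ek : wprod (altw k i j) = wprod (altw k j i).
    by apply/eqP; rewrite eq_mulgV1 altw_order expg_order.
  rewrite size_altw /= big_cons -ek; case: (k) kpos => // k' _ /=.
  rewrite big_cons sreflM => h; have := len_word (altw k' j i).
  by rewrite h size_altw ltnNge leqnSn.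
move=> hk; have -> : m = k by apply/eqP; rewrite eqn_leq hk dvdn_leq.
by rewrite !altw_prod braid.
Qed.

Lemma altw_rcons m i j : exists x, altw m.+1 i j = rcons (altw m i j) x.
Proof.
have [t e] := altw_cat m 1 i j; rewrite addn1 in e.
have : size t = 1%N.
  apply/eqP; rewrite -(eqn_add2l m) -{1}(size_altw m i j) -size_cat -e size_altw.
  by rewrite addn1.
by case: t e => [|x []] // e _; exists x; rewrite e cats1.
Qed.

Section Step.
Variable n : nat.
Hypothesis IH : forall t t', (size t <= n)%N -> reduced t -> size t = size t' ->
  wprod t = wprod t' -> tprod t = tprod t'.

Lemma same_head i t t' : size t = n -> reduced (i :: t) -> size t = size t' ->
  wprod (i :: t) = wprod (i :: t') -> tprod (i :: t) = tprod (i :: t').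
Proof.
rewrite !big_cons => st hr sz /mulgI e; congr (_ * _); apply: IH => //.
  by rewrite st.
by have [] := @reduced_cat [:: i] t hr.
Qed.

Lemma same_last x t t' : size t = n -> reduced (rcons t x) -> size t = size t' ->
  wprod (rcons t x) = wprod (rcons t' x) -> tprod (rcons t x) = tprod (rcons t' x).
Proof.
rewrite !big_rcons => st hr sz /mulIg e; congr (_ * _); apply: IH => //.
  by rewrite st.
by move: hr; rewrite -cats1 => /reduced_cat [].
Qed.

(** If the deleted letter is not the last one, the exchanged word shares its last letter with [t]
    and its head with [j :: t'], and induction settles both comparisons. Only deletion of the last
    letter is left open. *)
Lemma exchange_last t j t' : size t = n.+1 -> reduced t -> size t' = n ->
  wprod t = wprod (j :: t') ->
  tprod t = tprod (j :: t') \/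
  exists t0 x, t = rcons t0 x /\ wprod (j :: t0) = wprod t.
Proof.
move=> st hr st' e.
have hr' : reduced (j :: t') by apply: reduced_eq hr; rewrite // st /= st'.
have hneg : ~~ pos (al j *m rho (wprod t)) by rewrite e reduced_cons_neg.
have [t1 [y [t2 [et e12]]]] := exchange hneg.
have {}e12 : wprod (j :: t1 ++ t2) = wprod t by rewrite big_cons -e12 sreflM.
case/lastP: t2 et e12 => [|t2 z] et e12.
  right; exists t1, y; split; first by rewrite et cats1.
  by rewrite -e12 cats0.
left; have sz : size (t1 ++ rcons t2 z) = n.
  by move: st; rewrite et !size_cat /= addnS => -[].
rewrite -(@same_head j (t1 ++ rcons t2 z)) ?sz ?e12 //; last first.
  by apply: reduced_eq hr; rewrite ?st //= sz.
move: et e12 sz; rewrite -rcons_cat -rcons_cons -!rcons_cons -rcons_cat => et e12 sz.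
rewrite et; apply: same_last; rewrite -?et //.
  by move: st; rewrite et size_rcons => -[].
by move: st sz; rewrite et !size_rcons /= => -[->] ->.
Qed.

(* A word starting with [i j i ...] is pushed towards the purely alternating
   one by exchanging its last letter for one in front. *)
Lemma alternating_step t : forall i j m t', size (altw m.+1 i j ++ t) = n.+1 ->
  reduced (altw m.+1 i j ++ t) -> size t' = n ->
  wprod (altw m.+1 i j ++ t) = wprod (j :: t') ->
  tprod (altw m.+1 i j ++ t) = tprod (j :: t').
Proof.
elim/last_ind: t => [|t x IHt] i j m t' sz hr st' e.
  have [//|[t0 [x [et e0]]]] := exchange_last sz hr st' e.
  rewrite cats0 in sz hr e et e0 *.
  have [x' ex] := altw_rcons m i j.
  rewrite ex in et; have [et0 _] := rcons_inj et; subst t0.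
  rewrite -[j :: altw m i j]/(altw m.+1 j i) in e0.
  transitivity (tprod (altw m.+1 j i)); first exact (alternating_eq hr (esym e0)).
  apply: same_head => //.
  - by rewrite size_altw; move: sz; rewrite size_altw => -[].
  - by apply: (reduced_eq (esym e0) _ hr); rewrite !size_altw.
  - by rewrite size_altw st'; move: sz; rewrite size_altw => -[].
  - by rewrite [LHS]e0.
have [//|[t0 [y [et e0]]]] := exchange_last sz hr st' e.
rewrite -rcons_cat in et; have [et0 _] := rcons_inj et; subst t0.
have sz0 : size (altw m.+1 i j ++ t) = n.
  by move: sz; rewrite -rcons_cat size_rcons => -[].
have hr0 : reduced (j :: altw m.+1 i j ++ t).
  by apply: (reduced_eq (esym e0) _ hr); rewrite sz -sz0.
transitivity (tprod (j :: altw m.+1 i j ++ t)); last first.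
  by apply: same_head => //; [rewrite sz0 | rewrite e0].
(* [j :: altw m.+1 i j] is [altw m.+2 j i], so the induction on the tail applies with [i] and [j]
   exchanged. *)
symmetry; have := IHt j i m.+1 (altw m j i ++ rcons t x); apply => //.
- by rewrite -sz0.
- by move: sz => /= -[].
Qed.

End Step.

Lemma matsumoto t t' : reduced t -> size t = size t' -> wprod t = wprod t' ->
  tprod t = tprod t'.
Proof.
have [n] := ubnP (size t).
elim: n t t' => // n IH [|i t] [|j t'] // hs hr sz e.
have [{}sz] := sz.
(* Any word [i :: t] starts with the alternating word of length one. *)
apply: (@alternating_step (size t) _ t i j 0%N) => //.
move=> t1 t2 h1; apply: IH; exact: leq_ltn_trans h1 hs.
Qed.

Lemma reduced_wordP w : reduced (reduced_word rho Delta w) /\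
  wprod (reduced_word rho Delta w) = w.
Proof.
rewrite /reduced_word; case: pickP => [t /eqP e|h].
  by rewrite /reduced size_tuple e.
have [t st et] := word_ninv w; rewrite -wlenE in st.
have := h (tcast st (in_tuple t)).
by rewrite val_tcast /= -et eqxx.
Qed.

Lemma hecke_T_word t : reduced t -> hecke_T rho Delta T (wprod t) = tprod t.
Proof.
move=> hr; have [hr' e] := reduced_wordP (wprod t).
by apply: matsumoto => //; rewrite -(eqP hr') e (eqP hr).
Qed.

Lemma hecke_TM u w : len (u * w)%g = (len u + len w)%N ->
  hecke_T rho Delta T (u * w)%g = hecke_T rho Delta T u * hecke_T rho Delta T w.
Proof.
have [hu eu] := reduced_wordP u; have [hw ew] := reduced_wordP w.
move=> h; rewrite -{1}eu -{1}ew -big_cat hecke_T_word ?big_cat //.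
by rewrite /reduced size_cat big_cat /= -(eqP hu) -(eqP hw) eu ew h.
Qed.

Lemma hecke_T1 : hecke_T rho Delta T 1%g = 1.
Proof.
have := @hecke_T_word [::]; rewrite !big_nil; apply.
by rewrite /reduced big_nil len1.
Qed.

Lemma len_simple i : len (s i) = 1%N.
Proof.
by rewrite -[s i]mulg1 lenS ?len1 // (wg_1 hW) mulmx1 pos_simple.
Qed.

Lemma hecke_T_simple i : hecke_T rho Delta T (s i) = T i.
Proof.
have := @hecke_T_word [:: i]; rewrite !big_seq1; apply.
by rewrite /reduced big_seq1 len_simple.
Qed.

Lemma hecke_TS i w : pos (al i *m rho w) ->
  hecke_T rho Delta T (s i * w)%g = T i * hecke_T rho Delta T w.
Proof. by move=> h; rewrite hecke_TM ?hecke_T_simple // lenS // len_simple. Qed.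

Lemma hecke_TSr i w : pos (al i *m rho w^-1%g) ->
  hecke_T rho Delta T (w * s i)%g = hecke_T rho Delta T w * T i.
Proof. by move=> h; rewrite hecke_TM ?hecke_T_simple // lenSr // len_simple addn1. Qed.

End Matsumoto.

(** * The metaplectic lattice *)

Section MetaplecticLattice.
Variable Lam : {pred 'cV[R]_d}.
Hypothesis hLam : admissible_lattice Phi Lam.
Variable n : nat.
Hypothesis hn : (0 < n)%N.
Variable Q : 'cV[R]_d -> rat.
Hypothesis hQ : metaplectic_form Phi Q rho Lam.
Implicit Types y z : 'cV[R]_d.

Local Notation m := (mult n Q).
Local Notation L := (sublat Phi n Q Lam).

Lemma latB y z : y \in Lam -> z \in Lam -> y - z \in Lam.
Proof.
have [k [gens h]] := lat_fg hLam.
move=> /h [a ->] /h [b ->]; apply/h; exists [ffun i => a i - b i].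
by rewrite -sumrB; apply: eq_bigr => i _; rewrite ffunE mulrzBr.
Qed.

Lemma lat0 : 0 \in Lam.
Proof.
have [k [gens h]] := lat_fg hLam; apply/h; exists [ffun=> 0].
by rewrite big1 // => i _; rewrite ffunE mulr0z.
Qed.

Lemma latN y : y \in Lam -> - y \in Lam.
Proof. by move=> hy; rewrite -sub0r latB ?lat0. Qed.

Lemma latD y z : y \in Lam -> z \in Lam -> y + z \in Lam.
Proof. by move=> hy hz; rewrite -[z]opprK latB ?latN. Qed.

Lemma latMz y (k : int) : y \in Lam -> y *~ k \in Lam.
Proof.
move=> hy; elim: k => [|k IH|k IH]; first exact: lat0.
  by rewrite intS mulrzDr latD.
by rewrite intS opprD mulrzDr latD // mulrNz latN.
Qed.

Lemma coroot_in_lattice a : a \in Phi -> coroot_lattice Phi (coroot a).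
Proof.
move=> ha; set s := in_tuple [seq coroot b | b <- Phi].
have hi : (index a Phi < size [seq coroot b | b <- Phi])%N.
  by rewrite size_map index_mem.
exists [ffun i => (i == Ordinal hi)%:Z].
rewrite (bigD1 (Ordinal hi)) //= big1 => [|i hne]; last first.
  by rewrite ffunE (negPf hne) mulr0z.
by rewrite ffunE eqxx mulr1z addr0 (nth_map 0) ?index_mem // nth_index.
Qed.

Lemma coroot_lat a : a \in Phi -> coroot a \in Lam.
Proof. by move=> ha; apply/(lat_coroot hLam)/coroot_in_lattice. Qed.

Lemma ievE a y : a \in Phi -> y \in Lam -> (iev a y)%:~R = ev a y.
Proof. by move=> ha hy; rewrite /iev floorK // (lat_int hLam). Qed.

Lemma refl_mx_int a y : a \in Phi -> y \in Lam ->
  refl_mx a *m y = y - coroot a *~ iev a y.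
Proof. by move=> ha hy; rewrite refl_mxE -(ievE ha hy) scaler_int. Qed.

Lemma lat_rho w y : y \in Lam -> rho w *m y \in Lam.
Proof.
elim/rho_ind: w => [|a w ha IH] hy; first by rewrite (wg_1 hW) mul1mx.
rewrite (wg_M hW) (wg_refl hW) // -mulmxA refl_mx_int ?IH //.
by rewrite latB ?IH // latMz // coroot_lat.
Qed.

Lemma mult_gt0 a : (0 < m a)%N.
Proof. by rewrite divn_gt0 ?gcdn_gt0 ?hn // dvdn_leq // dvdn_gcdl. Qed.

Lemma mult_act a w : a \in Phi -> m (a *m rho w) = m a.
Proof.
by move=> ha; rewrite /mult coroot_rho (mf_W hQ) // coroot_lat.
Qed.

Lemma multN a : a \in Phi -> m (- a) = m a.
Proof.
move=> ha; rewrite -(mult_act (sref rho a) ha) (wg_refl hW) //.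
by rewrite row_refl_id // root_neq0.
Qed.

Lemma bformC y z : bform Q y z = bform Q z y.
Proof. by rewrite /bform [y + z]addrC addrAC. Qed.

Lemma Q0 : Q 0 = 0.
Proof. by have := mf_scale hQ 0 lat0; rewrite !mulr0z expr2 !mul0r. Qed.

Lemma bform0 y : bform Q 0 y = 0.
Proof. by rewrite /bform add0r Q0 subr0 subrr. Qed.

Lemma bformB y y' z : y \in Lam -> y' \in Lam -> z \in Lam ->
  bform Q (y - y') z = bform Q y z - bform Q y' z.
Proof.
move=> hy hy' hz; apply/eqP; rewrite eq_sym subr_eq -(mf_add hQ) ?latB //.
by rewrite subrK.
Qed.

Lemma bformMz y z (k : int) : y \in Lam -> z \in Lam ->
  bform Q (y *~ k) z = k%:~R * bform Q y z.
Proof.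
move=> hy hz; elim: k => [|k IH|k IH].
- by rewrite mulr0z bform0 mul0r.
- by rewrite intS mulrzDr mulr1z (mf_add hQ) ?latMz // IH intrD mulrDl mul1r.
rewrite intS opprD mulrzDr mulrN1z addrC bformB ?latMz // IH.
by rewrite intrD mulrDl mulrN1z mulN1r addrC.
Qed.

Lemma bform_rho w y z : y \in Lam -> z \in Lam ->
  bform Q (rho w *m y) (rho w *m z) = bform Q y z.
Proof. by move=> hy hz; rewrite /bform -mulmxDr !(mf_W hQ) ?latD. Qed.

Lemma bform_self y : y \in Lam -> bform Q y y = 2 * Q y.
Proof.
move=> hy; rewrite /bform -mulr2n; have := mf_scale hQ 2 hy => ->.
by rewrite expr2 -addrA -opprD -mulr2n -[Q y *+ 2]mulr_natl -mulrBl.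
Qed.

(** Invariance under the reflection in [a], which negates the coroot, gives 2 B(y, a^vee) = a(y)
    B(a^vee, a^vee), and B(z, z) = 2 Q(z). *)
Lemma bform_coroot a y : a \in Phi -> y \in Lam ->
  bform Q y (coroot a) = (iev a y)%:~R * Q (coroot a).
Proof.
move=> ha hy; have hc := coroot_lat ha.
have := bform_rho (sref rho a) hy hc; rewrite (wg_refl hW) // !refl_mx_int //.
have -> : iev a (coroot a) = 2.
  by rewrite /iev ev_coroot_id ?root_neq0 // (intrKfloor 2).
have -> : coroot a - coroot a *~ 2 = - coroot a.
  by rewrite -[coroot a *~ 2]/(coroot a + coroot a) opprD addrA subrr add0r.
have hN z : z \in Lam -> bform Q z (- coroot a) = - bform Q z (coroot a).
  by move=> hz; rewrite bformC -sub0r bformB ?lat0 // bform0 sub0r bformC.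
rewrite hN ?latB ?latMz // bformB ?latMz // bformMz // bform_self // opprB.
move/eqP; rewrite subr_eq => /eqP e.
have : 2 * ((iev a y)%:~R * Q (coroot a)) = 2 * bform Q y (coroot a).
  by rewrite mulrCA e mulrDl mul1r.
by move=> e2; apply/esym; apply: (@mulfI _ (2 : rat)) e2.
Qed.

Lemma Qcoroot a : a \in Phi -> (Num.floor (Q (coroot a)))%:~R = Q (coroot a).
Proof. by move=> ha; rewrite floorK ?(mf_int hQ) //; apply: coroot_in_lattice. Qed.

(** Moves divisibility from m(a), which varies with the root, to the fixed modulus n, so that
    different roots can be compared. *)
Lemma mult_dvd a (k : int) :
  ((m a : int) %| k)%Z = ((n : int) %| Num.floor (Q (coroot a)) * k)%Z.
Proof.
rewrite /mult !dvdzE abszM /=; set q := `|Num.floor _|%N.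
have g0 : (0 < gcdn n q)%N by rewrite gcdn_gt0 hn.
rewrite -[X in _ = (X %| _)%N](divnK (dvdn_gcdl n q)).
rewrite -[X in _ = (_ %| X * _)%N](divnK (dvdn_gcdr n q)) mulnAC dvdn_pmul2r //.
rewrite Gauss_dvdr // /coprime -(eqn_pmul2r g0) mul1n.
by rewrite muln_gcdl !divnK ?dvdn_gcdl ?dvdn_gcdr.
Qed.

Lemma latP y : reflect (y \in Lam /\ forall a, a \in Phi -> ((m a : int) %| iev a y)%Z)
  (y \in L).
Proof. by rewrite inE; apply: (iffP andP) => -[h /allP]. Qed.

Lemma iev_act a w y : iev a (rho w *m y) = iev (a *m rho w) y.
Proof. by rewrite /iev ev_mul. Qed.

Lemma ievB a y z : a \in Phi -> y \in Lam -> z \in Lam ->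
  iev a (y - z) = iev a y - iev a z.
Proof.
move=> ha hy hz; apply: (@intr_inj R); rewrite intrB !ievE ?latB //.
by rewrite evD evN.
Qed.

Lemma subL y : y \in L -> y \in Lam.
Proof. by case/latP. Qed.

Lemma LB y z : y \in L -> z \in L -> y - z \in L.
Proof.
move=> /latP [hy hya] /latP [hz hza]; apply/latP; split=> [|a ha].
  exact: latB.
by rewrite ievB // rpredB ?hya ?hza.
Qed.

Lemma L0 : 0 \in L.
Proof.
apply/latP; split=> [|a ha]; first exact: lat0.
by rewrite /iev ev0 (intrKfloor 0) dvdz0.
Qed.

Lemma LN y : y \in L -> - y \in L.
Proof. by move=> hy; rewrite -sub0r LB ?L0. Qed.

Lemma LD y z : y \in L -> z \in L -> y + z \in L.
Proof. by move=> hy hz; rewrite -[z]opprK LB ?LN. Qed.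

Lemma LMz y (k : int) : y \in L -> y *~ k \in L.
Proof.
move=> hy; elim: k => [|k IH|k IH]; first exact: L0.
  by rewrite intS mulrzDr LD.
by rewrite intS opprD mulrzDr LD // mulrNz LN.
Qed.

Lemma L_rho w y : y \in L -> rho w *m y \in L.
Proof.
move=> /latP [hy h]; apply/latP; split=> [|a ha]; first exact: lat_rho.
by rewrite iev_act -(mult_act w ha) h // root_act.
Qed.

(** The coroot of the rescaled root a / m(a). *)
Definition step a := coroot a *+ m a.

Lemma step_neq0 a : a \in Phi -> step a != 0.
Proof.
move=> ha; rewrite /step -scaler_nat scaler_eq0 negb_or pnatr_eq0 -lt0n mult_gt0 /=.
exact/coroot_neq0/root_neq0.
Qed.

(** By symmetry of B, Q(b^vee) b(a^vee) = Q(a^vee) a(b^vee), and n divides m(a) Q(a^vee); by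
    [mult_dvd] this gives the divisibility by m(b). *)
Lemma step_L a : a \in Phi -> step a \in L.
Proof.
move=> ha; have hc := coroot_lat ha; apply/latP; split=> [|b hb].
  by rewrite /step pmulrn latMz.
have -> : iev b (step a) = (m a)%:Z * iev b (coroot a).
  apply: (@intr_inj R); rewrite intrM !ievE //; last by rewrite /step pmulrn latMz.
  by rewrite /step -scaler_nat evZ.
have sym : Num.floor (Q (coroot b)) * iev b (coroot a) =
           Num.floor (Q (coroot a)) * iev a (coroot b).
  apply: (@intr_inj rat); rewrite !intrM !Qcoroot // [LHS]mulrC [RHS]mulrC.
  by rewrite -!bform_coroot // ?coroot_lat // bformC.
rewrite mult_dvd mulrCA sym mulrA dvdz_mulr // mulrC.
by rewrite -mult_dvd dvdzz.
Qed.

Lemma refl_mx_step a y : a \in Phi -> y \in L ->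
  refl_mx a *m y = y + step a *~ (- (iev a y %/ m a)%Z).
Proof.
move=> ha /latP [hy h]; rewrite refl_mx_int // /step; congr (_ + _).
by rewrite mulrNz pmulrn -mulrzA [_ * (_ %/ _)%Z]mulrC divzK ?h.
Qed.

Section BasePoint.
Variable c : 'cV[R]_d.
Hypothesis hc : in_C0 Phi n Q rho Delta Lam c.

Lemma C0_dom a : a \in Phi -> pos a -> 0 <= ev a c.
Proof. by move=> ha hp; have /andP [] := C0_bounds hc ha hp. Qed.

(** If a(c) = m(a), then s_a followed by the translation by [step a] would fix c, and [C0_stab]
    allows no nonzero translation part. *)
Lemma C0_lt a : a \in Phi -> pos a -> 0 <= iev a c < m a.
Proof.
move=> ha hp; have /andP [h1 h2] := C0_bounds hc ha hp; have hcl := C0_lat hc.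
rewrite -(ler0z R) ievE // h1 -(ltr_int R) ievE // lt_neqAle h2 andbT.
apply/negP => /eqP e.
have := (C0_stab hc (sref rho a) (step_L ha)).1; case.
  by rewrite (wg_refl hW) // refl_mxE e scaler_nat -/(step a) addrC subrK.
by move=> _ /eqP; rewrite (negPf (step_neq0 ha)).
Qed.

Lemma orbit_lat w : rho w *m c \in Lam.
Proof. by rewrite lat_rho // (C0_lat hc). Qed.

(** Here [C0_stab] makes the distinct x^{wc} independent over F[Lam^m]. *)
Lemma orbit_cong u w : rho u *m c - rho w *m c \in L -> rho u *m c = rho w *m c.
Proof.
move=> h; have h' := L_rho w^-1%g h.
have := (C0_stab hc (w^-1 * u)%g (LN h')).1; case.
  rewrite (wg_M hW) -!mulmxA mulmxBr (mulmxA _ (rho w)) rhoVK mul1mx.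
  by rewrite opprB subrK.
move=> hs _; have := stabM w hs; rewrite mulKVg; exact.
Qed.

Lemma iev_orbit i w : pos (al i *m rho w) ->
  ((iev (al i) (rho w *m c) %% m (al i))%Z = iev (al i) (rho w *m c)).
Proof.
move=> hp; have hi := simple_root i.
by rewrite modz_small // iev_act -(mult_act w hi) C0_lt // root_act.
Qed.

Lemma ibform_orbit i w : ibform Q (rho w *m c) (al i) = ibform Q c (al i *m rho w).
Proof.
have hi := coroot_lat (simple_root i).
rewrite /ibform coroot_rho -(bform_rho w (C0_lat hc)) ?lat_rho //.
by rewrite mulmxA rhoK mul1mx.
Qed.

Lemma ibform_perp i : ev (al i) c = 0 -> ibform Q c (al i) = 0.
Proof.
move=> h; rewrite /ibform bform_coroot ?simple_root ?(C0_lat hc) //.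
by rewrite /iev h (intrKfloor 0) mul0r (intrKfloor 0).
Qed.

End BasePoint.
(** * Demazure operators and the Hecke algebra *)

Section Demazure.
Variables (F : fieldType) (V : lmodType F).
Variables (co : 'cV[R]_d -> V -> F) (x : 'cV[R]_d -> V) (mul : V -> V -> V).
Hypothesis hV : group_algebra co x mul.
Variable act : 'M[R]_d -> V -> V.
Hypothesis hactP : forall M k f g, act M (k *: f + g) = k *: act M f + act M g.
Hypothesis hact_x : forall M y, act M (x y) = x (M *m y).
Implicit Types (f g q : V) (k : F) (M N : 'M[R]_d).

Local Notation supp := (supp co).
Local Notation quo := (quo mul).
Local Notation act_W w := (act (rho w)).

Lemma act0 M : act M 0 = 0.
Proof. by have := hactP M (-1) 0 0; rewrite scaler0 addr0 scaleN1r addNr. Qed.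

Lemma actD M f g : act M (f + g) = act M f + act M g.
Proof. by rewrite -[f]scale1r hactP !scale1r. Qed.

Lemma actZ M k f : act M (k *: f) = k *: act M f.
Proof. by rewrite -[k *: f]addr0 hactP act0 addr0. Qed.

Lemma actN M f : act M (- f) = - act M f.
Proof. by rewrite -scaleN1r actZ scaleN1r. Qed.

Lemma actB M f g : act M (f - g) = act M f - act M g.
Proof. by rewrite actD actN. Qed.

Lemma act_mul M f g : act M (mul f g) = mul (act M f) (act M g).
Proof.
elim/(ga_ind hV): f => [|k y f IH].
  by rewrite (ga_mul0l hV) act0 (ga_mul0l hV).
rewrite (ga_mulPl hV) !hactP (ga_mulPl hV) IH; congr (_ *: _ + _).
elim/(ga_ind hV): g {f IH} => [|l z g IH].
  by rewrite (ga_mul0r hV) !act0 (ga_mul0r hV).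
by rewrite (ga_mulPr hV) !hactP (ga_mulPr hV) IH (ga_mul_x hV) !hact_x (ga_mul_x hV) mulmxDr.
Qed.

Lemma actM M N f : act M (act N f) = act (M *m N) f.
Proof.
elim/(ga_ind hV): f => [|k y f IH].
  by rewrite !act0.
by rewrite !hactP IH !hact_x mulmxA.
Qed.

Lemma act1 f : act 1%:M f = f.
Proof.
elim/(ga_ind hV): f => [|k y f IH].
  by rewrite !act0.
by rewrite !hactP IH !hact_x mul1mx.
Qed.

Lemma act_WM u w f : act_W u (act_W w f) = act_W (u * w)%g f.
Proof. by rewrite actM (wg_M hW). Qed.

Lemma act_W1 f : act_W 1%g f = f.
Proof. by rewrite (wg_1 hW) act1. Qed.

Lemma supp_act w f : supp L f -> supp L (act_W w f).
Proof.
apply: (linear_supp hV (act0 _) (hactP _)) => y hy.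
by rewrite hact_x; apply/(supp_x hV)/L_rho.
Qed.

Definition binom i : V := x (step (al i)) - x 0.

Definition demazure i f : V := quo (act_W (s i) f - f) (binom i).

(** The linearity and equivariance of [demazure] are all checked through this lemma, after
    multiplication by [binom i]. *)
Lemma demazureE i f q : mul q (binom i) = act_W (s i) f - f -> demazure i f = q.
Proof. by apply/(quoP hV)/step_neq0/simple_root. Qed.

(** For y in Lam^m, s_i y - y is an integer multiple of [step (al i)], so the quotient is a
    geometric sum supported in Lam^m. *)
Lemma demazureP i f : supp L f ->
  supp L (demazure i f) /\ mul (demazure i f) (binom i) = act_W (s i) f - f.
Proof.
move=> hf; suff [q hq e] : exists2 q, supp L q & mul q (binom i) = act_W (s i) f - f.
  by rewrite (demazureE e).
elim/(supp_ind hV): f / hf => [|k y f hy hf [q hq e]].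
  exists 0; first exact: (ga_supp0 hV).
  by rewrite (ga_mul0l hV) act0 subrr.
have [p hp ep] := quo_geometric hV (- (iev (al i) y %/ m (al i))%Z)
  (fun j : int => LD hy (LMz j (step_L (simple_root i)))).
exists (k *: p + q); first exact: (suppP hV).
rewrite (ga_mulPl hV) [mul p _]ep e hactP hact_x rho_srefl.
by rewrite -refl_mx_step ?simple_root // scalerBr opprD addrACA.
Qed.

Lemma supp_demazure i f : supp L f -> supp L (demazure i f).
Proof. by case/(demazureP i). Qed.

Lemma mul_demazure i f : supp L f -> mul (demazure i f) (binom i) = act_W (s i) f - f.
Proof. by case/(demazureP i). Qed.

Lemma demazureLP i k f g : supp L f -> supp L g ->
  demazure i (k *: f + g) = k *: demazure i f + demazure i g.
Proof.
move=> hf hg; apply: demazureE.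
by rewrite (ga_mulPl hV) !mul_demazure // hactP scalerBr opprD addrACA.
Qed.

Lemma demazure0 i : demazure i 0 = 0.
Proof. by apply: demazureE; rewrite (ga_mul0l hV) act0 subrr. Qed.

Lemma demazure_srefl i f : supp L f -> demazure i (act_W (s i) f) = - demazure i f.
Proof.
move=> hf; apply: demazureE.
by rewrite (ga_mulNl hV) mul_demazure // act_WM sreflK act_W1 opprB.
Qed.

(** Since al_j^vee = - w0 al_i^vee, the denominator for j is w0 s_i applied to the one for i, and w0
    s_i negates s_i f - f up to replacing w0 s_i by w0. *)
Lemma demazure_longest i j f : (s j = w0 * s i * w0)%g -> al j = - (al i *m rho w0) ->
  supp L f -> demazure j (act_W w0 f) = - act_W w0 (act_W (s i) (demazure i f)).
Proof.
move=> ej eal hf; apply: demazureE.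
have hi := simple_root i; have hw := root_act w0 hi.
have -> : binom j = act_W w0 (act_W (s i) (binom i)).
  rewrite !actB !hact_x !mulmx0; congr (x _ - _).
  have -> : step (al j) = rho w0 *m coroot (- al i) *+ m (al i).
    by rewrite /step eal multN // mult_act // !corootN coroot_rho longestV mulmxN.
  have mulmxMn (M : 'M[R]_d) (y : 'cV[R]_d) (p : nat) : M *m (y *+ p) = (M *m y) *+ p.
    by rewrite -!scaler_nat scalemxAr.
  rewrite /step !mulmxMn; congr ((_ *m _) *+ _).
  rewrite rho_srefl refl_mxE ev_coroot_id ?root_neq0 // scaler_nat mulr2n.
  by rewrite opprD addrA subrr sub0r corootN.
rewrite (ga_mulNl hV) -!act_mul mul_demazure // actB act_WM sreflK act_W1.
rewrite -actN opprB actB; congr (_ - _); rewrite !act_WM ej -mulgA longestK.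
by rewrite mulg1.
Qed.

(** Substituting s_i f - f = D_i(f) (x^b - 1) with b = [step (al i)] gives D_i(f) (v^{1/2} x^b -
    v^{-1/2}) = 0, and a binomial is not a zero divisor. *)
Lemma demazure_fix i f (vh : F) : vh != 0 -> supp L f ->
  vh *: act_W (s i) f + (vh - vh^-1) *: demazure i f = vh *: f -> act_W (s i) f = f.
Proof.
move=> hv hf h; have e := mul_demazure i hf.
suff D0 : demazure i f = 0.
  by apply/eqP; rewrite -subr_eq0 -e D0 (ga_mul0l hV).
apply: (mul_binom_eq0 hV (step_neq0 (simple_root i)) hv (_ : - vh^-1 != 0)).
  by rewrite oppr_eq0 invr_eq0.
have : vh *: (act_W (s i) f - f) + (vh - vh^-1) *: demazure i f = 0.
  by rewrite scalerBr addrAC h subrr.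
rewrite -e /binom => <-; rewrite (ga_mulPr hV) (ga_mulZr hV) (ga_mulBr hV) (ga_mul_x0 hV).
by rewrite scalerBr scalerBl addrA subrK scaleNr.
Qed.

Section HeckeModule.
Variables (vh : F) (H : unitAlgType F) (T : 'I_r -> H) (X : 'cV[R]_d -> H).
Hypothesis hvh : vh != 0.
Local Notation kap := (vh - vh^-1).
Hypothesis braid : forall i j, let k := #[(s i * s j)%g]%g in
  alt_prod k (T i) (T j) = alt_prod k (T j) (T i).
Hypothesis quad : forall i, (T i - vh%:A) * (T i + (vh^-1)%:A) = 0.
Variable Xe : V -> H.
Hypothesis hXeP : forall k f g, Xe (k *: f + g) = k *: Xe f + Xe g.
Hypothesis hXe_x : forall y, Xe (x y) = X y.
Hypothesis cross : forall i y, y \in L ->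
  T i * X y - X (refl_mx (al i) *m y) * T i =
  kap *: Xe (quo (x (refl_mx (al i) *m y) - x y) (binom i)).

Local Notation Tt := (hecke_T rho Delta T).
Local Notation onep := (one_plus rho Delta vh T).

Lemma Xe0 : Xe 0 = 0.
Proof. by have := hXeP (-1) 0 0; rewrite scaler0 addr0 scaleN1r addNr. Qed.

Lemma XeZ k f : Xe (k *: f) = k *: Xe f.
Proof. by rewrite -[k *: f]addr0 hXeP Xe0 addr0. Qed.

Lemma T_Xe i f : supp L f ->
  T i * Xe f = Xe (act_W (s i) f) * T i + kap *: Xe (demazure i f).
Proof.
apply: (supp_ext hV (A := fun f => T i * Xe f)
  (B := fun f => Xe (act_W (s i) f) * T i + kap *: Xe (demazure i f))).
- by rewrite Xe0 mulr0.
- by rewrite act0 demazure0 Xe0 mul0r scaler0 addr0.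
- by move=> k g g' _ _; rewrite hXeP mulrDr scalerAr.
- move=> k g g' hg hg'; rewrite hactP demazureLP // !hXeP mulrDl !scalerDr scalerAl.
  by rewrite !scalerA [kap * k]mulrC addrACA.
move=> y hy; have := cross i hy; rewrite -rho_srefl -!hXe_x -hact_x => /eqP.
by rewrite subr_eq addrC => /eqP.
Qed.

Lemma T_sqr i : T i * T i = 1 + kap *: T i.
Proof.
have := quad i; rewrite mulrBl !mulrDr mulr_algr !mulr_algl scalerA mulfV // scale1r.
move/eqP; rewrite subr_eq0 => /eqP e; apply: (addIr (vh^-1 *: T i)).
by rewrite e scalerBl -addrA subrK addrC.
Qed.

Lemma T_inv i : T i * (T i - kap%:A) = 1.
Proof. by rewrite mulrBr mulr_algr T_sqr addrK. Qed.

Lemma T_inv_l i : (T i - kap%:A) * T i = 1.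
Proof. by rewrite mulrBl mulr_algl T_sqr addrK. Qed.

Lemma T_unit i : T i \is a GRing.unit.
Proof. by apply/unitrP; exists (T i - kap%:A); rewrite T_inv T_inv_l. Qed.

Lemma T_invE i : (T i)^-1 = T i - kap%:A.
Proof. by apply: (mulrI (T_unit i)); rewrite T_inv mulrV ?T_unit. Qed.

Lemma Tt_unit w : Tt w \is a GRing.unit.
Proof.
elim/len_ind: w => [|i w hp IH]; first by rewrite (hecke_T1 braid) unitr1.
by rewrite (hecke_TS braid) // unitrMl // T_unit.
Qed.

(** The pairs w < s_i w contribute multiples of (1 + v^{1/2} T_i) T_w, and T_i (1 + v^{1/2} T_i) =
    v^{1/2} (1 + v^{1/2} T_i). The set [S] will be W or W_c. *)
Lemma one_plus_srefl (S : {set W}) i : (forall w, (s i * w \in S)%g = (w \in S)) ->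
  T i * onep S = vh *: onep S.
Proof.
move=> hS.
have -> : onep S = \sum_(w in S | pos (al i *m rho w))
    (vh ^+ len w *: Tt w + vh ^+ (len w).+1 *: (T i * Tt w)).
  rewrite /one_plus (bigID (fun w => pos (al i *m rho w))) /= big_split /=.
  congr (_ + _); rewrite (reindex_inj (mulgI (s i))) /=.
  apply: eq_big => [w|w]; first by rewrite hS pos_simple_srefl negbK.
  rewrite hS pos_simple_srefl negbK => /andP [_ hp].
  by rewrite (hecke_TS braid) // lenS.
rewrite mulr_sumr scaler_sumr; apply: eq_bigr => w _.
rewrite mulrDr -!scalerAr mulrA T_sqr mulrDl mul1r -scalerAl !scalerDr !scalerA.
rewrite addrCA -scalerDl exprS; congr (_ + _ *: _).
by rewrite mulrBr [X in _ - X]mulrAC mulfV // mul1r addrC subrK mulrC.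
Qed.

Lemma one_plus_sreflr i : onep [set: W] * T i = vh *: onep [set: W].
Proof.
have -> : onep [set: W] = \sum_(w : W | pos (al i *m rho w^-1%g))
    (vh ^+ len w *: Tt w + vh ^+ (len w).+1 *: (Tt w * T i)).
  rewrite /one_plus (bigID (fun w => pos (al i *m rho w^-1%g))) /= big_split /=.
  congr (_ + _); first by apply: eq_bigl => w; rewrite inE.
  rewrite (reindex_inj (mulIg (s i))) /=.
  apply: eq_big => [w|w]; rewrite inE /= invMg sreflV pos_simple_srefl negbK // => hp.
  by rewrite (hecke_TSr braid) // lenSr.
rewrite mulr_suml scaler_sumr; apply: eq_bigr => w _.
rewrite mulrDl -!scalerAl -mulrA T_sqr mulrDr mulr1 -scalerAr !scalerDr !scalerA.
rewrite addrCA -scalerDl exprS; congr (_ + _ *: _).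
by rewrite mulrBr [X in _ - X]mulrAC mulfV // mul1r addrC subrK mulrC.
Qed.

(** * The metaplectic representation and its restriction to F[Lam^m] *)

Variable g : int -> F.
Hypothesis g_neq0 : forall j : int, g j != 0.
Hypothesis g_m1 : forall j : int, (n %| j)%Z -> g j = -1.
Variable pi : H -> V -> V.
Hypothesis pi_stable : forall h f, supp Lam f -> supp Lam (pi h f).
Hypothesis pi_lin : forall h k f f', supp Lam f -> supp Lam f' ->
  pi h (k *: f + f') = k *: pi h f + pi h f'.
Hypothesis pi_linH : forall k h h' f, supp Lam f ->
  pi (k *: h + h') f = k *: pi h f + pi h' f.
Hypothesis pi_1 : forall f, supp Lam f -> pi 1 f = f.
Hypothesis pi_M : forall h h' f, supp Lam f -> pi (h * h') f = pi h (pi h' f).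
Hypothesis pi_X : forall mu y, mu \in L -> y \in Lam -> pi (X mu) (x y) = x (y + mu).
Hypothesis pi_T : forall i y, y \in Lam ->
  pi (T i) (x y) = - (vh * g (- ibform Q y (al i))) *: x (refl_mx (al i) *m y) +
    kap *: mul (quo (x 0 - x (coroot (al i) *~ ((iev (al i) y %% m (al i))%Z - iev (al i) y)))
                    (x 0 - x (step (al i)))) (x y).

Lemma suppL f : supp L f -> supp Lam f.
Proof. by move=> hf z /hf /subL. Qed.

Lemma supp_mulL f q : supp L f -> supp Lam q -> supp Lam (mul f q).
Proof. by apply: (supp_mul hV) => y z /subL; apply: latD. Qed.

Lemma pi0 h : pi h 0 = 0.
Proof.
have h0 := @ga_supp0 _ _ _ _ _ _ _ hV Lam.
by have := pi_lin h (-1) h0 h0; rewrite scaler0 addr0 scaleN1r addNr.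
Qed.

Lemma piZ h k f : supp Lam f -> pi h (k *: f) = k *: pi h f.
Proof.
move=> hf; have := pi_lin h k hf (@ga_supp0 _ _ _ _ _ _ _ hV Lam).
by rewrite !addr0 pi0 addr0.
Qed.

Lemma piHZ k h f : supp Lam f -> pi (k *: h) f = k *: pi h f.
Proof.
move=> hf; have p0 : pi 0 f = 0.
  by have := pi_linH (-1) 0 0 hf; rewrite scaler0 addr0 scaleN1r addNr.
by rewrite -[k *: h]addr0 pi_linH // p0 addr0.
Qed.

Lemma piH0 f : supp Lam f -> pi 0 f = 0.
Proof. by move=> hf; rewrite -(scale0r 1) piHZ // scale0r. Qed.

Lemma piH_sum f (I : Type) (l0 : seq I) (P : pred I) (G : I -> H) : supp Lam f ->
  pi (\sum_(l <- l0 | P l) G l) f = \sum_(l <- l0 | P l) pi (G l) f.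
Proof.
move=> hf; apply: (big_morph (pi^~ f)) => [h h'|]; last exact: piH0.
by rewrite -[h]scale1r pi_linH // !scale1r.
Qed.

Lemma pi_Xe f q : supp L f -> supp Lam q -> pi (Xe f) q = mul f q.
Proof.
move=> hf hq; apply: (supp_ext hV (S := L) (A := fun f => pi (Xe f) q)
  (B := fun f => mul f q)) hf.
- by rewrite Xe0 piH0.
- exact: (ga_mul0l hV).
- by move=> k f1 f2 _ _; rewrite hXeP pi_linH.
- by move=> k f1 f2 _ _; rewrite (ga_mulPl hV).
move=> y hy; rewrite hXe_x.
apply: (supp_ext hV (S := Lam) (A := pi (X y)) (B := mul (x y))) hq.
- exact: pi0.
- exact: (ga_mul0r hV).
- exact: pi_lin.
- by move=> k f1 f2 _ _; rewrite (ga_mulPr hV).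
by move=> z hz; rewrite pi_X // (ga_mul_x hV) addrC.
Qed.

Lemma pi_T_mul i f q : supp L f -> supp Lam q ->
  pi (T i) (mul f q) =
    mul (act_W (s i) f) (pi (T i) q) + kap *: mul (demazure i f) q.
Proof.
move=> hf hq; have hsf := @supp_act (s i) f hf; have hdf := @supp_demazure i f hf.
rewrite -pi_Xe // -pi_M // T_Xe // -[_ * T i]scale1r pi_linH // scale1r pi_M //.
rewrite piHZ // !pi_Xe //; exact: pi_stable.
Qed.

Lemma pi_T_one i : pi (T i) (x 0) = vh *: x 0.
Proof.
rewrite pi_T ?lat0 // mulmx0 /ibform bform0 (intrKfloor 0) oppr0 g_m1 ?dvdz0 //.
rewrite /iev ev0 (intrKfloor 0) mod0z [0%Z - 0%Z]subrr mulr0z subrr.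
by rewrite (quo0 hV) ?step_neq0 ?simple_root // (ga_mul0l hV) scaler0 addr0 mulrN1 opprK.
Qed.

(** F[Lam^m] is generated by 1, an eigenvector because g_0 = -1, so it carries the usual polynomial
    representation. *)
Lemma pi_T_L i f : supp L f ->
  pi (T i) f = vh *: act_W (s i) f + kap *: demazure i f.
Proof.
move=> hf; rewrite -[in LHS](ga_mul_x0 hV f) pi_T_mul //; last first.
  by apply: (supp_x hV); exact: lat0.
by rewrite pi_T_one (ga_mulZr hV) !(ga_mul_x0 hV).
Qed.

(** [pi_stable] concerns F[Lam], whereas the coefficients live in F[Lam^m]; the property is needed
    for inverses of T_w as well. *)
Definition stable_L (h : H) := forall f, supp L f -> supp L (pi h f).

Lemma stable_LM h h' : stable_L h -> stable_L h' -> stable_L (h * h').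
Proof. by move=> hh hh' f hf; rewrite pi_M; [apply/hh/hh' | apply: suppL]. Qed.

Lemma stable_L1 : stable_L 1.
Proof. by move=> f hf; rewrite pi_1 //; apply: suppL. Qed.

Lemma stable_LT i : stable_L (T i).
Proof.
move=> f hf; rewrite pi_T_L //; apply: (suppP hV); first exact: supp_act.
by apply/(suppZ hV)/supp_demazure.
Qed.

Lemma stable_LTV i : stable_L (T i)^-1.
Proof.
move=> f hf; have hf' := suppL hf; rewrite T_invE addrC -scaleNr pi_linH // pi_1 //.
by apply: (suppP hV) => //; apply: stable_LT.
Qed.

Lemma stable_LTt w : stable_L (Tt w).
Proof.
elim/len_ind: w => [|i w hp IH]; first by rewrite (hecke_T1 braid); exact: stable_L1.
by rewrite (hecke_TS braid) //; apply: stable_LM => //; apply: stable_LT.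
Qed.

Lemma stable_LTtV w : stable_L (Tt w)^-1.
Proof.
elim/len_ind: w => [|i w hp IH].
  by rewrite (hecke_T1 braid) invr1; exact: stable_L1.
rewrite (hecke_TS braid) // invrM ?T_unit ?Tt_unit //.
by apply: stable_LM => //; apply: stable_LTV.
Qed.

Lemma stable_L_onep S : stable_L (onep S).
Proof.
move=> f hf; have hf' := suppL hf.
rewrite /one_plus piH_sum //; apply: (supp_sum hV) => w _.
by rewrite piHZ //; apply/(suppZ hV)/stable_LTt.
Qed.

(* Moving [T i] to the left across [f] and absorbing it in the symmetrizer
   replaces [f] by its image under the polynomial representation. *)
Lemma one_plus_Xe_T i f : supp L f ->
  onep [set: W] * Xe f * T i = onep [set: W] * Xe (pi (T i) f).
Proof.
move=> hf; rewrite pi_T_L // hXeP XeZ mulrDr -!scalerAr scalerAl -(one_plus_sreflr i).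
have hsf := @supp_act (s i) f hf.
rewrite -(mulrA _ (T i)) T_Xe // demazure_srefl // act_WM sreflK act_W1.
by rewrite -scaleN1r XeZ scaleN1r scalerN mulrBr -scalerAr subrK mulrA.
Qed.

Lemma one_plus_Xe_Tt w f : supp L f ->
  onep [set: W] * Xe f * Tt w = onep [set: W] * Xe (pi (Tt w^-1%g) f).
Proof.
elim/len_ind: w f => [|i w hp IH] f hf.
  by rewrite invg1 (hecke_T1 braid) mulr1 pi_1 //; apply: suppL.
rewrite (hecke_TS braid) // mulrA one_plus_Xe_T // IH; last exact: stable_LT.
by rewrite invMg sreflV (hecke_TSr braid) ?invgK // pi_M //; apply: suppL.
Qed.

(** * The action on the orbit of the base point *)

Variable c : 'cV[R]_d.
Hypothesis hc : in_C0 Phi n Q rho Delta Lam c.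
Variable ext : ('cV[R]_d -> V) -> V -> V.
Hypothesis extP : forall p k f f', ext p (k *: f + f') = k *: ext p f + ext p f'.
Hypothesis ext_x : forall p y, ext p (x y) = p y.
Implicit Types (psi : V).

Let hdom := C0_dom hc.

Local Notation Wc := (min_coset_reps rho Delta c).
Local Notation hfun := (hfun Phi Q rho Delta vh g c).

Definition xc w : V := x (rho w *m c).

(** W-invariance of B moves the index from w c to c, so that this is exactly the factor that h gains
    when s_i is put in front of [w]. *)
Definition eta i w : F := - (vh * g (- ibform Q c (al i *m rho w))).

Lemma eta_neq0 i w : eta i w != 0.
Proof. by rewrite oppr_eq0 mulf_neq0. Qed.

Lemma supp_xc w : supp Lam (xc w).
Proof. by apply: (supp_x hV); exact: orbit_lat. Qed.

(* The residue of [al i] at [w c] is [al i (w c)] itself, so that the second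
   term of [pi_T] vanishes. *)
Lemma pi_T_xc_up i w : pos (al i *m rho w) ->
  pi (T i) (xc w) = eta i w *: xc (s i * w)%g.
Proof.
move=> hp; rewrite /xc pi_T ?(orbit_lat hc) // iev_orbit // subrr mulr0z subrr.
rewrite (quo0 hV) ?step_neq0 ?simple_root // (ga_mul0l hV) scaler0 addr0.
by rewrite ibform_orbit // (wg_M hW) rho_srefl mulmxA.
Qed.

(** Apply T_i to the upward formula at s_i w and use T_i^2 = 1 + kappa T_i. *)
Lemma pi_T_xc_down i w : ~~ pos (al i *m rho w) ->
  pi (T i) (xc w) = (eta i (s i * w)%g)^-1 *: xc (s i * w)%g + kap *: xc w.
Proof.
rewrite -pos_simple_srefl => hp; have e := pi_T_xc_up hp; rewrite sreflM in e.
have hw := @supp_xc w; have hsw := @supp_xc (s i * w)%g.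
have e0 := eta_neq0 i (s i * w)%g.
have E : xc (s i * w)%g + kap *: (eta i (s i * w)%g *: xc w) =
    eta i (s i * w)%g *: pi (T i) (xc w).
  rewrite -piZ // -e -pi_M // T_sqr -[X in pi (X + _)]scale1r pi_linH // pi_1 //.
  by rewrite scale1r piHZ.
apply: (scalerI e0); rewrite -E scalerDr [X in _ = X + _]scalerA mulfV // scale1r.
by congr (_ + _); rewrite !scalerA mulrC.
Qed.

Lemma hfun1 : hfun 1%g = 1.
Proof.
rewrite /Defs.hfun len1 !expr0 !mul1r big_seq_cond big1 // => a /andP [ha].
by rewrite /inversion invg1 (wg_1 hW) mulmx1 neg_pos // andbN.
Qed.

Lemma hfun_srefl i w : pos (al i *m rho w) -> hfun (s i * w)%g = eta i w * hfun w.
Proof.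
move=> hp; rewrite /Defs.hfun lenS // big_inversion_srefl // /eta !exprS.
set A := (-1) ^+ _; set B := vh ^+ _; set C := \prod_(_ <- _ | _) _; set D := g _.
by rewrite mulN1r !mulNr -!mulrA; congr (- _); rewrite ![A * _]mulrCA ![B * _]mulrCA.
Qed.

Lemma pi_T_base i : ev (al i) c = 0 -> pi (T i) (xc 1%g) = vh *: xc 1%g.
Proof.
move=> h; rewrite pi_T_xc_up ?(wg_1 hW) ?mulmx1 ?pos_simple //.
rewrite /eta (wg_1 hW) mulmx1 (ibform_perp hc) // oppr0 g_m1 ?dvdz0 // mulrN1 opprK.
by congr (_ *: _); rewrite /xc mulg1 (wg_1 hW) mul1mx rho_srefl refl_mxE h scale0r subr0.
Qed.

(** An explicit form of the coordinate at x^{wc}: keep the monomials in w c + Lam^m and divide by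
    x^{wc}. It is linear on the whole space and depends only on w c. *)
Definition cosetpart w : V -> V :=
  ext (fun y => if y - rho w *m c \in L then x (y - rho w *m c) else 0).
Local Notation cf := cosetpart.

Lemma cfP w k f f' : cf w (k *: f + f') = k *: cf w f + cf w f'.
Proof. exact: extP. Qed.

Lemma cf0 w : cf w 0 = 0.
Proof. by have := cfP w (-1) 0 0; rewrite scaler0 addr0 scaleN1r addNr. Qed.

Lemma cfZ w k f : cf w (k *: f) = k *: cf w f.
Proof. by rewrite -[k *: f]addr0 cfP cf0 addr0. Qed.

Lemma cfD w f f' : cf w (f + f') = cf w f + cf w f'.
Proof. by rewrite -[f]scale1r cfP !scale1r. Qed.

Lemma cf_sum w (I : Type) (l0 : seq I) (P : pred I) (G : I -> V) :
  cf w (\sum_(l <- l0 | P l) G l) = \sum_(l <- l0 | P l) cf w (G l).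
Proof. by apply: (big_morph (cf w)) => [f f'|]; [apply: cfD | apply: cf0]. Qed.

Lemma supp_cf w f : supp L (cf w f).
Proof.
apply: (linear_supp hV (S := predT) (cf0 w) (cfP w)) => // y _.
rewrite /cosetpart ext_x; case: ifP => h; [exact: (supp_x hV) | exact: (ga_supp0 hV)].
Qed.

Lemma cf_mul_xc w u f : supp L f ->
  cf w (mul f (xc u)) = if rho u *m c == rho w *m c then f else 0.
Proof.
apply: (supp_ext hV (S := L) (A := fun f => cf w (mul f (xc u)))
  (B := fun f => if rho u *m c == rho w *m c then f else 0)).
- by rewrite (ga_mul0l hV) cf0.
- by case: ifP.
- by move=> k f1 f2 _ _; rewrite (ga_mulPl hV) cfD cfZ.
- by move=> k f1 f2 _ _; case: ifP => // _; rewrite scaler0 addr0.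
move=> y hy; rewrite (ga_mul_x hV) /cosetpart ext_x -addrA.
have [->|hne] := eqVneq (rho u *m c) (rho w *m c); first by rewrite subrr addr0 hy.
case: ifP => // h; case/eqP: hne; apply: (orbit_cong hc).
by rewrite -[_ - _](addKr y) LD // LN.
Qed.

(** A filtration by length of the module spanned over F[Lam^m] by the x^{wc}. Here w runs over all
    of W, so that T_i raises [k] by at most one without any choice of representatives. *)
Inductive span (k : nat) : V -> Prop :=
| span0 : span k 0
| spanS f w psi : supp L f -> (len w < k)%N -> span k psi ->
    span k (mul f (xc w) + psi).

Lemma span_gen (k : nat) f w : supp L f -> (len w < k)%N -> span k (mul f (xc w)).
Proof. by move=> hf hw; rewrite -[mul _ _]addr0; apply: spanS => //; apply: span0. Qed.

Lemma spanD (k : nat) psi psi' : span k psi -> span k psi' -> span k (psi + psi').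
Proof.
by elim=> [|f w p hf hw _ IH] h; rewrite ?add0r // -addrA; apply: spanS => //; apply: IH.
Qed.

Lemma spanZ (k : nat) (l : F) psi : span k psi -> span k (l *: psi).
Proof.
elim=> [|f w p hf hw _ IH]; first by rewrite scaler0; apply: span0.
by rewrite scalerDr -(ga_mulZl hV); apply: spanS => //; apply: (suppZ hV).
Qed.

Lemma span_supp (k : nat) psi : span k psi -> supp Lam psi.
Proof.
elim=> [|f w p hf _ _ IH]; first exact: (ga_supp0 hV).
by apply: (suppD hV) => //; apply: supp_mulL => //; apply: supp_xc.
Qed.

Lemma span_orbit (k : nat) psi : span k psi -> supp (orbit_pts Phi n Q rho Lam c) psi.
Proof.
elim=> [|f w p hf _ _ IH]; first exact: (ga_supp0 hV).
apply: (suppD hV) => //.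
apply: (supp_mul hV (S := L) (S' := pred1 (rho w *m c))) => //.
  move=> y z hy /eqP ->; rewrite inE; apply/existsP; exists w.
  by rewrite addrK.
by apply: (supp_x hV); exact: eqxx.
Qed.

Lemma span_sum (k : nat) (I : Type) (l0 : seq I) (P : pred I) (G : I -> V) :
  (forall l, P l -> span k (G l)) -> span k (\sum_(l <- l0 | P l) G l).
Proof. by move=> h; elim/big_ind: _ => //; [apply: span0 | apply: spanD]. Qed.

Lemma span_T (k : nat) i psi : span k psi -> span k.+1 (pi (T i) psi).
Proof.
elim=> [|f w p hf hw hp IH]; first by rewrite pi0; apply: span0.
have hf1 := @supp_act (s i) f hf; have hf2 := @supp_demazure i f hf.
have hx := @supp_xc w; have hm := supp_mulL hf hx; have hp' := span_supp hp.
rewrite -[mul f _]scale1r pi_lin // scale1r; apply: spanD => //.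
rewrite pi_T_mul //; apply: spanD; last first.
  by apply/spanZ/span_gen => //; apply: ltnW.
have hs : (len (s i * w)%g < k.+1)%N.
  by rewrite ltnS (leq_trans (len_le_srefl i w)).
have [hu|hd] := boolP (pos (al i *m rho w)).
  by rewrite pi_T_xc_up // (ga_mulZr hV); apply/spanZ/span_gen.
rewrite pi_T_xc_down // (ga_mulPr hV) (ga_mulZr hV).
by apply: spanD; apply/spanZ/span_gen => //; apply: ltnW.
Qed.

Lemma span_Tt (k : nat) w psi : span k psi -> exists k' : nat, span k' (pi (Tt w) psi).
Proof.
elim/len_ind: w => [|i w hp IH] h.
  by exists k; rewrite (hecke_T1 braid) pi_1 //; apply: span_supp h.
have [k' h'] := IH h; exists k'.+1; rewrite (hecke_TS braid) // pi_M.
  exact: span_T.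
exact: span_supp h.
Qed.

Lemma span_all (k : nat) psi : span k psi -> span #|W| psi.
Proof.
elim=> [|f w p hf hw _ IH]; first exact: span0.
by apply: spanS => //; rewrite wlenE ninv_lt.
Qed.

(** If u c = w c with [w] minimal, then u is at least as long as [w], so no term of length below [k]
    reaches the coset of w c. *)
Lemma cf_span_low (k : nat) w psi : w \in Wc -> span k psi -> (k <= len w)%N -> cf w psi = 0.
Proof.
move=> hw; elim=> [|f u p hf hu _ IH] hk; first exact: cf0.
rewrite cfD IH // cf_mul_xc // addr0; case: eqP => // e.
have := len_min_rep hdom hw (stabP e); rewrite mulKVg => el.
by have := leq_trans hu hk; rewrite el ltnNge leq_addr.
Qed.

Lemma srefl_orbit_inj i u w : rho (s i * u)%g *m c = rho (s i * w)%g *m c ->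
  rho u *m c = rho w *m c.
Proof.
move/(congr1 (mulmx (rho (s i)))).
by rewrite !mulmxA -!(wg_M hW) !sreflM.
Qed.

(** Only u c = w c and u c = s_i w c contribute: the first through the Demazure term, the second
    through the downward move from s_i w to w. *)
Lemma cf_T_gen i w u f : pos (al i *m rho w) -> rho (s i * w)%g *m c != rho w *m c ->
  supp L f -> cf w (pi (T i) (mul f (xc u))) =
  (eta i w)^-1 *: act_W (s i) (cf (s i * w)%g (mul f (xc u))) +
  kap *: demazure i (cf w (mul f (xc u))).
Proof.
move=> hp hne hf; have hx := @supp_xc u.
have hf1 := @supp_act (s i) f hf; have hf2 := @supp_demazure i f hf.
rewrite pi_T_mul // cfD cfZ !cf_mul_xc //.
(* x^{uc} depends only on u c, so in these two cases [u] is replaced by [w] or s_i w, whose position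
   relative to s_i is known. *)
have [e|ne] := eqVneq (rho u *m c) (rho w *m c).
  rewrite e eq_sym (negPf hne) act0 scaler0 add0r /xc e -/(xc w).
  rewrite pi_T_xc_up // (ga_mulZr hV) cfZ cf_mul_xc // (negPf hne) scaler0 add0r //.
have [e|ne'] := eqVneq (rho u *m c) (rho (s i * w)%g *m c).
  rewrite scaler0 addr0 demazure0 scaler0 addr0 /xc e -/(xc _) pi_T_xc_down.
    rewrite sreflM (ga_mulPr hV) (ga_mulZr hV) cfD !cfZ !cf_mul_xc //.
    by rewrite eqxx (negPf hne) scaler0 addr0.
  by rewrite pos_simple_srefl negbK.
rewrite act0 demazure0 !scaler0 !addr0.
have ne2 : rho (s i * u)%g *m c != rho w *m c.
  apply: contraNneq ne' => e; apply/eqP/(@srefl_orbit_inj i).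
  by rewrite sreflM.
have [hu|hd] := boolP (pos (al i *m rho u)).
  by rewrite pi_T_xc_up // (ga_mulZr hV) cfZ cf_mul_xc // (negPf ne2) scaler0.
rewrite pi_T_xc_down // (ga_mulPr hV) (ga_mulZr hV) cfD !cfZ !cf_mul_xc //.
by rewrite (negPf ne) (negPf ne2) !scaler0 addr0.
Qed.

Lemma cf_T (k : nat) i w psi : pos (al i *m rho w) -> rho (s i * w)%g *m c != rho w *m c ->
  span k psi -> cf w (pi (T i) psi) =
  (eta i w)^-1 *: act_W (s i) (cf (s i * w)%g psi) + kap *: demazure i (cf w psi).
Proof.
move=> hp hne; elim=> [|f u p hf hu hs IH].
  by rewrite pi0 !cf0 act0 demazure0 !scaler0 addr0.
have hm := supp_mulL hf (@supp_xc u); have hs' := span_supp hs.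
have h1 := @supp_cf w (mul f (xc u)); have h2 := @supp_cf w p.
rewrite -[mul f _]scale1r pi_lin // !cfD !cfZ !scale1r IH cf_T_gen //.
rewrite actD -[cf w (mul _ _)]scale1r demazureLP // !scale1r !scalerDr.
by rewrite addrACA.
Qed.

Lemma leading_term u f : supp L f -> exists2 psi, span (len u) psi &
  pi (Tt u) (mul f (xc 1%g)) = hfun u *: mul (act_W u f) (xc u) + psi.
Proof.
move=> hf; have hx := @supp_xc 1; have hm := supp_mulL hf hx.
elim/len_ind: u => [|i u hp [psi hpsi IH]].
  exists 0; first exact: span0.
  by rewrite (hecke_T1 braid) pi_1 // hfun1 scale1r act_W1 addr0.
have hu := @supp_act u f hf; have hxu := @supp_xc u; have hmu := supp_mulL hu hxu.
have hs := span_supp hpsi; have hd := @supp_demazure i _ hu.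
(* The Demazure term stays at x^{uc}, which is already lower than s_i u. *)
exists (hfun u *: (kap *: mul (demazure i (act_W u f)) (xc u)) + pi (T i) psi).
  rewrite lenS //; apply: spanD; last exact: span_T.
  by apply/spanZ/spanZ/span_gen.
rewrite (hecke_TS braid) // pi_M // IH pi_lin // pi_T_mul // pi_T_xc_up //.
rewrite (ga_mulZr hV) scalerDr scalerA addrA; congr (_ + _ + _).
by rewrite hfun_srefl // act_WM mulrC.
Qed.

(** For s_i in W_c, x^c and 1 are eigenvectors of T_i with the same eigenvalue v^{1/2}, so
    multiplication by x^c commutes with T_i on F[Lam^m]. *)
Lemma pi_Tt_base u f : u \in stab rho c -> supp L f ->
  pi (Tt u) (mul f (xc 1%g)) = mul (pi (Tt u) f) (xc 1%g).
Proof.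
move=> hu; have hx := @supp_xc 1; elim/(stab_ind hdom): u / hu f => [|u i hu hi hp IH] f hf.
  rewrite (hecke_T1 braid) !pi_1 //; last exact: supp_mulL.
  exact: suppL.
have hm := supp_mulL hf hx; have hfL := suppL hf; have hTf := @stable_LT i f hf.
rewrite (hecke_TSr braid) // !pi_M // -IH // [in RHS]pi_T_L // pi_T_mul //.
by rewrite pi_T_base // (ga_mulPl hV) (ga_mulZr hV) (ga_mulZl hV).
Qed.

Lemma pi_onep_base f : supp L f ->
  pi (onep (stab rho c)) (mul f (xc 1%g)) = mul (pi (onep (stab rho c)) f) (xc 1%g).
Proof.
move=> hf; have hx := @supp_xc 1; have hm := supp_mulL hf hx; have hfL := suppL hf.
rewrite /one_plus !piH_sum // (ga_mul_suml hV); apply: eq_bigr => u hu.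
by rewrite !piHZ // pi_Tt_base // (ga_mulZl hV).
Qed.

Lemma onep_min_rep :
  onep [set: W] = (\sum_(w in Wc) vh ^+ len w *: Tt w) * onep (stab rho c).
Proof.
rewrite /one_plus (sum_min_rep hdom) mulr_suml; apply: eq_bigr => w hw.
rewrite mulr_sumr; apply: eq_bigr => u hu.
have hl := len_min_rep hdom hw hu.
by rewrite hl (hecke_TM braid) // -scalerAl -scalerAr scalerA exprD.
Qed.

Lemma pi_T_onep i (S : {set W}) f : supp Lam f ->
  (forall w, (s i * w \in S)%g = (w \in S)) ->
  pi (T i) (pi (onep S) f) = vh *: pi (onep S) f.
Proof. by move=> hf hS; rewrite -pi_M // one_plus_srefl // piHZ. Qed.

Lemma stab_srefl i w : ev (al i) c = 0 -> (s i * w \in stab rho c)%g = (w \in stab rho c).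
Proof.
move=> h; have hs := srefl_stab h; apply/idP/idP => hw; last exact: in_stabM.
by rewrite -(sreflM i w) in_stabM.
Qed.

(** * Coefficients of the symmetrized element *)

Section Invariant.
Variable phi : V.
Hypothesis phi_L : supp L phi.
Hypothesis phi_T : forall i, ev (al i) c = 0 -> pi (T i) phi = vh *: phi.

Lemma stab_phi u : u \in stab rho c -> act_W u phi = phi.
Proof.
move=> hu; elim/(stab_ind hdom): u / hu => [|u i hu hi hp IH]; first exact: act_W1.
rewrite -act_WM (demazure_fix hvh phi_L) // -pi_T_L //; exact: phi_T.
Qed.

Lemma Tt_phi u : u \in stab rho c -> pi (Tt u) phi = vh ^+ len u *: phi.
Proof.
move=> hu; have hL := suppL phi_L; elim/(stab_ind hdom): u / hu => [|u i hu hi hp IH].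
  by rewrite (hecke_T1 braid) pi_1 // len1 scale1r.
by rewrite (hecke_TSr braid) // pi_M // phi_T // piZ // IH lenSr // scalerA exprS.
Qed.

Definition sym_phi : V := \sum_(w in Wc) vh ^+ len w *: pi (Tt w) (mul phi (xc 1%g)).

Lemma cf_top w : w \in Wc -> (w * stab_longest c = w0)%g ->
  cf w sym_phi = (hfun w * vh ^+ len w) *: act_W w phi.
Proof.
move=> hw e; rewrite /sym_phi cf_sum (bigD1 w) //= big1 => [|u /andP [hu hne]].
  have [psi hpsi ->] := @leading_term w _ phi_L.
  have h1 := @supp_act w _ phi_L.
  rewrite cfZ cfD cfZ cf_mul_xc // eqxx (cf_span_low hw hpsi) // !addr0 scalerA.
  by rewrite mulrC.
have [psi hpsi ->] := @leading_term u _ phi_L.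
have hl := len_min_rep_top hdom hw e hu hne.
have h1 := @supp_act u _ phi_L.
rewrite cfZ cfD cfZ cf_mul_xc // (cf_span_low hw hpsi) 1?ltnW // addr0.
case: eqP => [/(min_rep_uniq hdom hu hw) eu|_]; last by rewrite !scaler0.
by rewrite eu eqxx in hne.
Qed.

Lemma pi_T_longest i j f : (s j = w0 * s i * w0)%g -> al j = - (al i *m rho w0) ->
  supp L f ->
  pi (T j) (act_W w0 f) = act_W w0 (act_W (s i) (vh *: f - kap *: demazure i f)).
Proof.
move=> ej eal hf; have h := @supp_act w0 _ hf.
rewrite pi_T_L // (demazure_longest ej eal hf) scalerN actB actB !actZ.
by congr (_ *: _ - _); rewrite !act_WM ej -mulgA longestK mulg1.
Qed.

(* Downward induction on W^c for the left weak order: comparing coefficients at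
   [w] in [T i psi = vh psi] expresses the one at [s i * w] through the one at
   [w], by an invertible operator. *)
Lemma cf_symmetric (k : nat) psi : span k psi ->
  (forall i, pi (T i) psi = vh *: psi) ->
  (forall w, w \in Wc -> (w * stab_longest c = w0)%g ->
    cf w psi = (hfun w * vh ^+ len w) *: act_W w phi) ->
  forall w, w \in Wc -> cf w psi =
    (hfun w * vh ^+ len w0) *: act_W w0 (pi (Tt (w0 * w)^-1%g)^-1 phi).
Proof.
move=> hpsi hT htop w; have [p] := ubnP (len w0 - len w).
elim: p w => // p IH w hp hw; have hL := suppL phi_L.
have [/existsP [i /andP [hi hne]]|] :=
  boolP [exists i, pos (al i *m rho w) && (rho (s i * w)%g *m c != rho w *m c)];
  last first.
  (* No upward move is left, so w u0 = w0. The formula agrees with [htop] because [phi] is fixed by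
     u0 and is an eigenvector of T_{u0}. *)
  rewrite negb_exists => /forallP h.
  have e : (w * stab_longest c = w0)%g.
    apply: (min_rep_top hdom hw) => i hi.
    by have := h i; rewrite hi negbK => /eqP.
  have [hu0 _] := stab_longestP c.
  have ew : (w0 * w)^-1%g = stab_longest c.
    by apply/eqP; rewrite eq_invg_mul -mulgA e longestK.
  have v0 : vh ^+ len (stab_longest c) != 0 by rewrite expf_neq0.
  have E : pi (Tt (stab_longest c))^-1 phi = (vh ^+ len (stab_longest c))^-1 *: phi.
    apply: (scalerI v0); rewrite scalerA mulfV // scale1r -piZ // -Tt_phi // -pi_M //.
    by rewrite mulVr ?Tt_unit // pi_1.
  rewrite htop // ew E actZ scalerA -e -act_WM (stab_phi hu0).
  by rewrite (len_min_rep hdom hw hu0) exprD !mulrA mulfK.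
have hw' := srefl_min_rep_up hdom hw hi hne.
have hlt : (len (s i * w)%g <= len w0)%N by apply: len_longest.
have hp' : (len w0 - len (s i * w)%g < p)%N.
  move: hlt; rewrite lenS // => hlt.
  exact: leq_trans (ltn_sub2l hlt (ltnSn _)) hp.
have [j ej eal] := longest_simple i.
have hC := @supp_cf w psi; have hwC := @supp_act w0 _ hC.
have hpos : pos (al j *m rho (w0 * (s i * w))%g).
  rewrite eal mulNmx (wg_M hW w0) mulmxA -(mulmxA (al i)) -(wg_M hW) longestK.
  by rewrite (wg_1 hW) mulmx1 simple_act_srefl opprK.
have eT : Tt (w0 * w)^-1%g = Tt (w0 * (s i * w))^-1%g * T j.
  rewrite -(hecke_TSr braid) ?invgK //; congr (Tt _).
  rewrite -{1}(sreflV j) -invMg ej; congr (_^-1)%g.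
  by rewrite -!mulgA (mulgA w0 w0) longestK mul1g sreflM.
have hZ : supp L (pi (Tt (w0 * (s i * w))^-1%g)^-1 phi) by apply: stable_LTtV.
have hZL := suppL hZ.
(* In the coefficient of T_i psi = v^{1/2} psi at [w], the factor [eta i w] from h(s_i w) cancels
   its inverse in [cf_T]. *)
have := cf_T hi hne hpsi; rewrite hT cfZ (IH _ hp' hw') hfun_srefl // => E.
have e0 := eta_neq0 i w.
have E2 : vh *: cf w psi - kap *: demazure i (cf w psi) =
    (hfun w * vh ^+ len w0) *:
      act_W (s i) (act_W w0 (pi (Tt (w0 * (s i * w))^-1%g)^-1 phi)).
  rewrite E addrK actZ scalerA -mulrA mulKf //.
have E3 : pi (T j) (act_W w0 (cf w psi)) =
    (hfun w * vh ^+ len w0) *: pi (Tt (w0 * (s i * w))^-1%g)^-1 phi.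
  rewrite (pi_T_longest ej eal) // E2 !actZ !act_WM -!mulgA sreflM longestK.
  by rewrite act_W1.
have hwCL := suppL hwC.
have E4 : act_W w0 (cf w psi) =
    (hfun w * vh ^+ len w0) *: pi (Tt (w0 * w)^-1%g)^-1 phi.
  rewrite eT invrM ?T_unit ?Tt_unit // pi_M // -piZ // -E3 -pi_M //.
  by rewrite mulVr ?T_unit // pi_1.
by rewrite -[LHS]act_W1 -longestK -act_WM E4 actZ.
Qed.

End Invariant.
Lemma coefficient_formula (gamma : W -> V -> V)
  (hgamma : forall f, supp (orbit_pts Phi n Q rho Lam c) f ->
     (forall w, w \in Wc -> supp L (gamma w f)) /\
     f = \sum_(w in Wc) mul (gamma w f) (x (rho w *m c)))
  w' w f : w \in Wc -> supp L f ->
  gamma w (pi (onep [set: W] * Xe f * Tt w') (x c)) =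
  (hfun w * vh ^+ len w0) *:
    act_W w0 (pi ((Tt (w0 * w)^-1%g)^-1 * onep (stab rho c) * Tt w'^-1%g) f).
Proof.
move=> hw hf; have hfL := suppL hf; have hx := @supp_xc 1.
pose f1 := pi (Tt w'^-1%g) f; have hf1 : supp L f1 by apply: stable_LTt.
pose phi := pi (onep (stab rho c)) f1; have hphi : supp L phi by apply: stable_L_onep.
have hf1L := suppL hf1; have hm := supp_mulL hf1 hx; have hm' := supp_mulL hphi hx.
have -> : x c = xc 1%g by rewrite /xc (wg_1 hW) mul1mx.
have e : pi (onep [set: W] * Xe f * Tt w') (xc 1%g) = pi (onep [set: W]) (mul f1 (xc 1%g)).
  by rewrite one_plus_Xe_Tt // pi_M // pi_Xe.
have es : pi (onep [set: W]) (mul f1 (xc 1%g)) = sym_phi phi.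
  rewrite onep_min_rep pi_M // pi_onep_base // piH_sum //; apply: eq_bigr => u _.
  by rewrite piHZ.
have hphiT i : ev (al i) c = 0 -> pi (T i) phi = vh *: phi.
  by move=> h; apply: pi_T_onep => // u; apply: stab_srefl.
have hspan : span #|W| (sym_phi phi).
  apply: span_sum => u _; apply: spanZ.
  have h1 : span 1 (mul phi (xc 1%g)) by apply: span_gen; rewrite // len1.
  by have [k hk] := span_Tt u h1; apply: span_all hk.
have hT i : pi (T i) (sym_phi phi) = vh *: sym_phi phi.
  by rewrite -es; apply: pi_T_onep => // u; rewrite !inE.
have htop u : u \in Wc -> (u * stab_longest c = w0)%g ->
    cf u (sym_phi phi) = (hfun u * vh ^+ len u) *: act_W u phi by apply: cf_top.
rewrite e es -mulrA !pi_M // -/f1 -/phi -(cf_symmetric hphi hphiT hspan hT htop) //.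
(* Applying [cf w] to the expansion given by [gamma] isolates one term, since distinct minimal
   representatives have distinct images of c. *)
have [hg hd] := hgamma _ (span_orbit hspan).
have hg' u : u \in Wc -> cf w (mul (gamma u (sym_phi phi)) (x (rho u *m c))) =
    if rho u *m c == rho w *m c then gamma u (sym_phi phi) else 0.
  by move=> hu; have hgu := hg u hu; apply: cf_mul_xc.
rewrite [in RHS]hd cf_sum (bigD1 w) //= hg' // eqxx big1 ?addr0 // => u /andP [hu hne].
rewrite hg' //; case: eqP => // /(min_rep_uniq hdom hu hw) eu.
by rewrite eu eqxx in hne.
Qed.

End HeckeModule.

End Demazure.

End MetaplecticLattice.

End WeylCombinatorics.

Theorem theorem6p1
  (R : realType) (d : nat) (Phi : {fset 'rV[R]_d})
  (hPhi : irreducible_root_system Phi)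
  (r : nat) (Delta : r.-tuple 'rV[R]_d) (hDelta : is_base Phi Delta)
  (W : finGroupType) (rho : W -> 'M[R]_d) (hW : is_weyl_group rho Phi)
  (Lam : {pred 'cV[R]_d}) (hLam : admissible_lattice Phi Lam)
  (n : nat) (hn : (0 < n)%N)
  (Q : 'cV[R]_d -> rat) (hQ : metaplectic_form Phi Q rho Lam)
  (F : fieldType) (v vh : F) (hv : v != 0) (hvh : vh ^+ 2 = v)
  (g : int -> F) (hg : gauss_parameters n v g)
  (H : unitAlgType F) (T : 'I_r -> H) (X : 'cV[R]_d -> H)
  (hH : is_hecke_algebra Phi n Q rho Delta Lam vh T X)
  (pi : H -> galg R d F -> galg R d F)
  (hpi : metaplectic_rep Phi n Q Delta Lam vh g T X pi)
  (c : 'cV[R]_d) (hc : in_C0 Phi n Q rho Delta Lam c)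
  (gamma : W -> galg R d F -> galg R d F)
  (hgamma : coordinate_functions Phi n Q rho Delta Lam c gamma)
  (w' w : W) (hw' : w' \in min_coset_reps rho Delta c)
  (hw : w \in min_coset_reps rho Delta c)
  (f : galg R d F) (hf : supported (sublat Phi n Q Lam) f) :
  let Tw := hecke_T rho Delta T in
  let one_p := one_plus rho Delta vh T in
  let w0 := longest rho Delta in
  gamma w (pi (one_p [set: W] * x_embed X f * Tw w') (xpow F c)) =
  (hfun Phi Q rho Delta vh g c w * vh ^+ wlen rho Delta w0) *:
    xact (rho w0)
      (pi ((Tw (w0 * w)^-1%g)^-1 * one_p (stab rho c) * Tw w'^-1%g) f).
Proof.
move=> Tw one_p w0.
have suppE S q : supp (fun z q => q@_z) S q <-> @supported R d F S q.
  by split=> h y hy; apply: h; rewrite ?mcoeff_neq0 // -mcoeff_neq0.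
have [rel _] := hH.
have vh0 : vh != 0 by apply: contraNneq hv => h; rewrite -hvh h expr0n.
apply: (coefficient_formula hPhi hDelta hW hLam hn hQ (galg_group_algebra R d F)
  (@xactP R d F) (@xact_xpow R d F) vh0 (hr_braid rel) (hr_quad rel)
  (lext_is_linear X) (lext_xpow X) (hr_cross rel) (gp_neq0 hg) (gp_m1 hg)
  _ _ _ _ _ _ _ hc (fun p => lext_is_linear p) (fun p => lext_xpow p)).
- by move=> h q /suppE hq; apply/suppE/(mr_stable hpi).
- by move=> h k q q' /suppE hq /suppE; apply: (mr_linear hpi).
- by move=> k h h' q /suppE; apply: (mr_linearH hpi).
- by move=> q /suppE; apply: (mr_1 hpi).
- by move=> h h' q /suppE; apply: (mr_M hpi).
- exact: (mr_X hpi).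
- exact: (mr_T hpi).
- move=> q /suppE /hgamma [hs e]; split=> // u /hs hu; exact/suppE.
- exact: hw.
- exact/suppE.
Qed.
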